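(* As $n\to\infty$ over the positive integers, there are at least $$\exp\Big(\tfrac14(\log 2)\,n^2+O(n\log n)\Big)$$ and at most $$\exp\Big(\tfrac12(1+\log 2)\,n^2+O(n\log n)\Big)$$ indecomposable algebraic integers of degree up to $n$.
   Context: $\overline{\mathbb{Q}}$ is an algebraic closure of $\mathbb{Q}$ and $\overline{\mathbb{Z}}\subseteq\overline{\mathbb{Q}}$ is the ring of algebraic integers. The degree of $\alpha\in\overline{\mathbb{Z}}$ is $[\mathbb{Q}(\alpha):\mathbb{Q}]$. $\overline{\mathbb{Q}}$ carries the inner product $$\langle\alpha,\beta\rangle=\frac{1}{[\mathbb{Q}(\alpha,\beta):\mathbb{Q}]}\sum_{\sigma:\mathbb{Q}(\alpha,\beta)\to\mathbb{C}}\sigma(\alpha)\cdot\overline{\sigma(\beta)},$$ where the sum ranges over all field embeddings of $\mathbb{Q}(\alpha,\beta)$ in $\mathbb{C}$. A decomposition of $\alpha\in\overline{\mathbb{Z}}$ is a pair $(\beta,\gamma)\in\overline{\mathbb{Z}}^2$ with $\alpha=\beta+\gamma$ and $\langle\beta,\gamma\rangle\geq0$. An element $\alpha\in\overline{\mathbb{Z}}$ is indecomposable if $\alpha\neq 0$ and its only decompositions are $(\alpha,0)$ and $(0,\alpha)$. *)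

(* Defs.v *)
From HB Require Import structures.
From mathcomp Require Import all_boot all_order all_algebra all_field.
From mathcomp Require Import finmap complex.
From mathcomp Require Import all_classical all_reals all_analysis.

Set Implicit Arguments.
Unset Strict Implicit.
Unset Printing Implicit Defensive.

Import Order.TTheory GRing.Theory Num.Theory.
Import numFieldNormedType.Exports.

Local Open Scope classical_set_scope.
Local Open Scope ring_scope.

(* Throughout, algC plays the role of the algebraic closure of Q, and Aint is
   its subring of algebraic integers.  The field C is R[i]. *)

(* Q(s), as an abstract number field, with its inclusion into algC and the
   elements of it that correspond to s.  It is obtained from num_field_exists;
   numfield_gensP determines it up to a unique isomorphism over algC. *)
Definition numfield (s : seq algC) : fieldExtType rat :=
  projT1 (num_field_exists s).

Definition numfield_incl (s : seq algC) : {rmorphism numfield s -> algC} :=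
  projT1 (projT2 (num_field_exists s)).

Definition numfield_gens (s : seq algC) : seq (numfield s) :=
  s2val (projT2 (projT2 (num_field_exists s))).

Lemma numfield_gensP (s : seq algC) :
  map (numfield_incl s) (numfield_gens s) = s /\
  <<1 & numfield_gens s>>%VS = fullv.
Proof.
by split; rewrite /numfield_incl /numfield_gens;
  case: (projT2 (projT2 (num_field_exists s))).
Qed.

Definition degree (a : algC) : nat := \dim {:numfield [:: a]}.

(* Embeddings are taken as plain functions, on which equality is extensional,
   so that each embedding is counted once. *)
Definition embeddings (R : realType) (K : fieldExtType rat) : set (K -> R[i]) :=
  range (fun s : {rmorphism K -> R[i]} => (s : K -> R[i])).

Arguments embeddings : clear implicits.

Definition inner (R : realType) (a b : algC) : R[i] :=
  let K := numfield [:: a; b] in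
  let a' := (numfield_gens [:: a; b])`_0 in
  let b' := (numfield_gens [:: a; b])`_1 in
  (\dim {:K})%:R^-1 *
  \sum_(s \in embeddings R K) (s a' * (s b')^*).

(* In R[i], 0 <= z means that z is real and nonnegative; inner R b c is always
   real, because the embeddings come in complex conjugate pairs. *)
Definition decomposition (R : realType) (a b c : algC) : Prop :=
  [/\ b \in Aint, c \in Aint, a = b + c & 0 <= inner R b c].

Definition indecomposable (R : realType) (a : algC) : Prop :=
  [/\ a \in Aint, a != 0 &
      forall b c, decomposition R a b c -> (b, c) = (a, 0) \/ (b, c) = (0, a)].

Definition indecomposables_upto (R : realType) (n : nat) : set algC :=
  [set a | indecomposable R a /\ (degree a <= n)%N].

(* Main.v *)
Require Import Defs.
From HB Require Import structures.
From mathcomp Require Import all_boot all_order all_algebra all_field.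
From mathcomp Require Import finmap complex.
From mathcomp Require Import all_classical all_reals all_analysis.
From mathcomp Require Import ring lra zify.

(** Write q(a) for the mean of |w|^2 over the conjugates w of a.  In any number field K containing a,
    each conjugate of a is the image of a under the same number of embeddings ([embeddings_roots]), so
    q(a) = <a, a> can be computed in any K.  In particular, if a = b + c, then
    q(a) = q(b) + q(c) + 2 <b, c>, as <b, c> is real.

    Lower bound.  A nonzero algebraic integer b has q(b) >= 1, by the inequality between arithmetic
    and geometric means, since its norm is a nonzero integer.  A decomposition of a into two nonzero
    parts thus needs q(a) >= 2, and an integer all of whose conjugates have modulus less than sqrt 2
    is indecomposable ([indecomposable_of_small_conjugates]).  A monic polynomial of degree n has all
    its roots in that disc when its coefficient of X^(n - k) is at most about sqrt 2^k / n in modulus.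
    Among these polynomials, those that are Eisenstein at 2 with a fixed constant term lose only a
    factor exp(O(n ln n)), and each is the minimal polynomial of its roots.  Their number is the
    product of the sqrt 2^k up to such factors, that is exp((ln 2) n^2 / 4 + O(n ln n)).

    Upper bound.  A pair (b, a - b) of integers is a decomposition of a exactly when
    q(b - a/2) <= q(a) / 4.  If q(a) > 4, put r = sqrt(q(a)) / 2 > 1.  Discs of radius r > 1 around the
    halves of the conjugates of a contain all the conjugates of some algebraic integer b
    ([Aint_near_half]), whence a nontrivial decomposition; so an indecomposable a has q(a) <= 4
    ([sum_conjugates_le4]).  Then a is a root of a monic integer polynomial of degree n whose roots
    have mean modulus at most 2, and the coefficient of X^j of such a polynomial is at most
    2^(n - j) n^n / (j^j (n - j)^(n - j)) ([coef_entropy_bound]).  The product of these bounds over j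
    is exp((1 + ln 2) n^2 / 2 + O(n ln n)), by the comparison of the sum of the j ln j with the
    integral of x ln x ([sum_xlnx_ge]). *)

Set Implicit Arguments.
Unset Strict Implicit.
Unset Printing Implicit Defensive.

Import Order.TTheory GRing.Theory Num.Theory.
Import numFieldNormedType.Exports.

Local Open Scope classical_set_scope.
Local Open Scope ring_scope.

(** * Embeddings of a number field and conjugates of its elements *)

Definition is_rat_minpoly (K : fieldExtType rat) (a : K) (p : {poly rat}) : Prop :=
  p \is monic /\ forall q, root (map_poly (in_alg K) q) a = (p %| q).

Lemma adjoin1_horner (K : fieldExtType rat) (t : K) (a : K) :
  a \in <<1; t>>%VS -> exists p : {poly rat}, a = (map_poly (in_alg K) p).[t].
Proof.
by case/Fadjoin_polyP => q /polyOver1P [p ->] ->; exists p.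
Qed.

Lemma rmorph_horner_rat (C : numFieldType) (K : fieldExtType rat)
    (s : {rmorphism K -> C}) (p : {poly rat}) (a : K) :
  s (map_poly (in_alg K) p).[a] = (map_poly ratr p).[s a].
Proof.
rewrite -horner_map -map_poly_comp; congr (_.[_]).
by apply: eq_map_poly => x /=; rewrite rmorphZ_num rmorph1 mulr1.
Qed.

(** An element of K is a rational polynomial in t, determined modulo p; evaluating that
    polynomial at z instead of t is therefore well defined and multiplicative. *)
Lemma rmorph_of_root (C : numFieldType) (K : fieldExtType rat) (t : K) (p : {poly rat}) (z : C) :
  <<1; t>>%VS = fullv -> is_rat_minpoly t p -> root (map_poly ratr p) z ->
  exists s : {rmorphism K -> C}, s t = z.
Proof.
move=> tgen [pm pP] pz.
have ev a : {q : {poly rat} | a == (map_poly (in_alg K) q).[t]}.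
  apply: sigW; have [|q ->] := @adjoin1_horner K t a; first by rewrite tgen memvf.
  by exists q.
have uni (q : {poly rat}) : (map_poly (in_alg K) q).[t] = 0 -> (map_poly ratr q).[z] = 0 :> C.
  move=> q0; have : p %| q by rewrite -pP; apply/rootP.
  case/dvdpP=> r ->; rewrite rmorphM hornerM.
  by move/rootP: pz => ->; rewrite mulr0.
pose s a : C := (map_poly ratr (sval (ev a))).[z].
have sE (a : K) (q : {poly rat}) : a = (map_poly (in_alg K) q).[t] -> s a = (map_poly ratr q).[z].
  move=> aE; apply/eqP; rewrite -subr_eq0 /s -hornerN -hornerD -rmorphB; apply/eqP/uni.
  rewrite rmorphB hornerD hornerN -aE; case: (ev a) => r /= /eqP {1}->.
  by rewrite subrr.
have evE (a : K) : a = (map_poly (in_alg K) (sval (ev a))).[t] by case: (ev a) => r /= /eqP.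
have sB : {morph s : x y / x - y}.
  move=> x y; rewrite (sE (x - y) (sval (ev x) - sval (ev y))).
    by rewrite rmorphB hornerD hornerN.
  by rewrite rmorphB hornerD hornerN -!evE.
have sM : {morph s : x y / x * y}.
  move=> x y; rewrite (sE (x * y) (sval (ev x) * sval (ev y))).
    by rewrite rmorphM hornerM.
  by rewrite rmorphM hornerM -!evE.
have s1 : s 1 = 1 by rewrite (sE 1 1) ?rmorph1 ?hornerE.
pose mA := GRing.isZmodMorphism.Build K C s sB.
pose mM := GRing.isMonoidMorphism.Build K C s (conj s1 sM).
pose sr : {rmorphism K -> C} := HB.pack s mA mM.
exists sr; rewrite /= (sE t 'X) ?map_polyX ?hornerX //.
Qed.

Lemma rat_minpoly_exists (K : fieldExtType rat) (a : K) :
  exists p, is_rat_minpoly a p.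
Proof.
have /polyOver1P [p pE] := minPolyOver 1%AS a.
exists p; split.
  by have := monic_minPoly 1 a; rewrite pE !monicE lead_coef_map fmorph_eq1.
move=> q; rewrite -(dvdp_map (in_alg K)) -pE.
apply/idP/idP => [|/dvdpP [r ->]].
  by apply: minPoly_dvdp; apply/polyOver1P; exists q.
by rewrite rootM root_minPoly orbT.
Qed.

Lemma dim_adjoin_rat_minpoly (K : fieldExtType rat) (a : K) (p : {poly rat}) :
  is_rat_minpoly a p -> \dim <<1; a>> = (size p).-1.
Proof.
move=> [pm pP].
have E : map_poly (in_alg K) p = minPoly 1 a.
  apply/eqP; rewrite -eqp_monic ?monic_minPoly ?map_monic //.
  apply/andP; split.
    have /polyOver1P [q qE] := minPolyOver 1%AS a.
    by rewrite qE dvdp_map -pP -qE root_minPoly.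
  apply: minPoly_dvdp; first by apply/polyOver1P; exists p.
  by rewrite pP dvdpp.
by rewrite dim_Fadjoin dimv1 muln1 -(size_map_poly (in_alg K) p) E size_minPoly.
Qed.

Lemma primitive_element (K : fieldExtType rat) : exists t : K, <<1; t>>%VS = fullv.
Proof.
exists (separable_generator 1 {:K}).
rewrite -(@eq_adjoin_separable_generator _ _ {:K}%AS 1%AS) ?sub1v //.
apply/separableP => y _; apply: pcharf0_separable => q.
by rewrite pchar_lalg; apply: pchar_num.
Qed.

Lemma separable_minPoly (K : fieldExtType rat) (F : {subfield K}) (t : K) :
  separable_poly (minPoly F t).
Proof.
apply: pcharf0_separable => q.
by rewrite pchar_lalg; apply: pchar_num.
Qed.

Lemma separable_rat_minpoly (K : fieldExtType rat) (a : K) (p : {poly rat}) :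
  is_rat_minpoly a p -> separable_poly p.
Proof.
move=> [pm pP].
rewrite -(separable_map (in_alg K)).
apply: dvdp_separable (separable_minPoly 1%AS a).
have /polyOver1P [q qE] := minPolyOver 1%AS a.
by rewrite qE dvdp_map -pP -qE root_minPoly.
Qed.

(** Fibres of restriction.  Sending a to w embeds Q(a) in C; this carries the minimal polynomial
    of t over Q(a) to a separable polynomial over C of degree [K : Q(a)], and each of its roots
    is the image of t under an embedding of K that sends a to w. *)
Lemma extensions_above_root (C : numClosedFieldType) (K : fieldExtType rat)
    (t a : K) (p m P : {poly rat}) (w : C) :
  <<1; t>>%VS = fullv -> is_rat_minpoly t p -> is_rat_minpoly a m ->
  a = (map_poly (in_alg K) P).[t] -> root (map_poly ratr m) w ->
  exists rs : seq C, [/\ uniq rs, (size rs * (size m).-1 = \dim {:K})%N &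
    {in rs, forall z, root (map_poly ratr p) z /\ (map_poly ratr P).[z] = w}].
Proof.
move=> tgen pP mP aE wm.
pose F := <<1; a>>%AS.
pose a' : subvs_of F := Subvs (memv_adjoin 1%AS a).
have valE (q : {poly rat}) : map_poly vsval (map_poly (in_alg (subvs_of F)) q) = map_poly (in_alg K) q.
  rewrite -map_poly_comp; apply: eq_map_poly => x; congr (_ *: _).
  exact: (rmorph1 (vsval : subvs_of F -> K)).
have hornE (q : {poly rat}) :
    vsval (map_poly (in_alg (subvs_of F)) q).[a'] = (map_poly (in_alg K) q).[a].
  by rewrite -horner_map valE.
have a'gen : <<1; a'>>%VS = fullv.
  apply/eqP; rewrite eqEsubv subvf /=; apply/subvP=> x _.
  have [q qE] := adjoin1_horner (valP x).
  have -> : x = (map_poly (in_alg (subvs_of F)) q).[a'] by apply: val_inj; rewrite /= hornE -qE.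
  by apply: mempx_Fadjoin; apply/polyOver1P; exists q.
have m'P : is_rat_minpoly a' m.
  split; first by case: mP.
  move=> q; case: mP => _ <-; rewrite !rootE -hornE.
  by rewrite (fmorph_eq0 vsval).
have [phi phiE] := rmorph_of_root a'gen m'P wm.
have /polyOver_subvs [q qE] := minPolyOver F t.
have qm : q \is monic by have := monic_minPoly F t; rewrite qE map_monic.
have rphi (r : {poly rat}) : map_poly phi (map_poly (in_alg (subvs_of F)) r) = map_poly ratr r.
  rewrite -map_poly_comp; apply: eq_map_poly => x /=.
  by rewrite rmorphZ_num rmorph1 mulr1.
pose qw := map_poly phi q.
have [rs rsE] := closed_field_poly_normal qw.
have qwm : qw \is monic by rewrite map_monic.
rewrite (monicP qwm) scale1r in rsE.
exists rs; split.
- rewrite -separable_prod_XsubC -rsE separable_map.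
  by rewrite -(separable_map vsval) -qE separable_minPoly.
- have : size rs = adjoin_degree F t.
    apply: succn_inj; rewrite -size_minPoly qE size_map_poly -(size_map_poly phi) -/qw rsE.
    by rewrite size_prod_XsubC.
  move=> ->; rewrite -(dim_adjoin_rat_minpoly mP) -dim_Fadjoin.
  congr (\dim _); apply/eqP; rewrite eqEsubv subvf -tgen /=.
  by apply: adjoinSl; apply: sub1v.
- move=> z; rewrite -root_prod_XsubC -rsE => zq; split.
    have : q %| map_poly (in_alg (subvs_of F)) p.
      rewrite -(dvdp_map vsval) -qE valE; apply: minPoly_dvdp.
        by apply/polyOver_subvs; exists (map_poly (in_alg (subvs_of F)) p); rewrite valE.
      by case: pP => _ ->.
    rewrite -(dvdp_map phi) rphi => /dvdpP [r ->].
    by rewrite rootM zq orbT.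
  have : q %| map_poly (in_alg (subvs_of F)) P - a'%:P.
    have vE : map_poly vsval (map_poly (in_alg (subvs_of F)) P - a'%:P) = map_poly (in_alg K) P - a%:P.
      by rewrite rmorphB /= valE map_polyC.
    rewrite -(dvdp_map vsval) -qE vE; apply: minPoly_dvdp.
      by apply/polyOver_subvs; exists (map_poly (in_alg (subvs_of F)) P - a'%:P).
    by rewrite rootE hornerD hornerN hornerC -aE subrr.
  rewrite -(dvdp_map phi) rmorphB /= rphi map_polyC /= phiE => /dvdpP [r rE].
  have /rootP := zq; rewrite -/qw => zq0.
  apply/eqP; rewrite -subr_eq0 -[X in _ - X](hornerC w z) -hornerN -hornerD rE.
  by rewrite hornerM zq0 mulr0.
Qed.

(** The fact that makes means over embeddings independent of the field: under the embeddings of K,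
    each conjugate of a is taken equally often.  By [extensions_above_root] it is taken at least
    [K : Q(a)] times, and the total [K : Q] leaves no room for more. *)
Lemma embeddings_roots (C : numClosedFieldType) (K : fieldExtType rat) :
  exists e : 'I_(\dim {:K}) -> {rmorphism K -> C},
  [/\ forall i j, e i =1 e j -> i = j,
      forall s : {rmorphism K -> C}, exists i, s =1 e i &
      forall (a : K) (m : {poly rat}) (T : seq C) (f : C -> C),
        is_rat_minpoly a m -> map_poly ratr m = \prod_(w <- T) ('X - w%:P) ->
        (size m).-1%:R * \sum_i f (e i a) = (\dim {:K})%:R * \sum_(w <- T) f w].
Proof.
have [t tgen] := primitive_element K.
have [p pP] := rat_minpoly_exists t.
have [S pS] := closed_field_poly_normal (map_poly (ratr : rat -> C) p).
have pm : map_poly (ratr : rat -> C) p \is monic by rewrite map_monic; case: pP.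
rewrite (monicP pm) scale1r in pS.
have uS : uniq S by rewrite -separable_prod_XsubC -pS separable_map (separable_rat_minpoly pP).
have sS : size S = \dim {:K}.
  rewrite -tgen (dim_adjoin_rat_minpoly pP) -(size_map_poly (ratr : {rmorphism rat -> C})) pS.
  by rewrite size_prod_XsubC.
have ex (i : 'I_(\dim {:K})) : exists s : {rmorphism K -> C}, s t = S`_i.
  apply: (rmorph_of_root tgen pP); rewrite pS root_prod_XsubC mem_nth // sS //.
have [e eE] := fin_all_exists ex.
have ext (s1 s2 : {rmorphism K -> C}) : s1 t = s2 t -> s1 =1 s2.
  move=> st a; have [|P ->] := @adjoin1_horner K t a; first by rewrite tgen memvf.
  by rewrite !rmorph_horner_rat st.
exists e; split.
- move=> i j /(_ t); rewrite !eE => /eqP; rewrite nth_uniq ?sS // => /eqP.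
  exact: val_inj.
- move=> s; have : s t \in S.
    rewrite -root_prod_XsubC -pS /root -rmorph_horner_rat.
    have /rootP -> : root (map_poly (in_alg K) p) t by case: pP => _ ->.
    by rewrite rmorph0.
  case/(nthP (0 : C)) => i; rewrite sS => iN iE.
  by exists (Ordinal iN); apply: ext; rewrite eE.
move=> a m T f mP mT.
have [|P aP] := @adjoin1_horner K t a; first by rewrite tgen memvf.
have uT : uniq T by rewrite -separable_prod_XsubC -mT separable_map (separable_rat_minpoly mP).
have sT : size T = (size m).-1.
  by rewrite -(size_map_poly (ratr : {rmorphism rat -> C})) mT size_prod_XsubC.
pose ev z := (map_poly ratr P).[z] : C.
have eaE i : e i a = ev S`_i by rewrite aP rmorph_horner_rat eE.
have evT i : e i a \in T.
  rewrite -root_prod_XsubC -mT /root -rmorph_horner_rat.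
  have /rootP -> : root (map_poly (in_alg K) m) a by case: mP => _ ->.
  by rewrite rmorph0.
pose k := (\dim {:K} %/ (size m).-1)%N.
have dE : (k * (size m).-1 = \dim {:K})%N.
  by rewrite divnK // -(dim_adjoin_rat_minpoly mP); apply: field_dimS (subvf _).
have dgt : (0 < (size m).-1)%N.
  by rewrite lt0n; apply/eqP => d0; move: dE (adim_gt0 {:K}%AS); rewrite d0 muln0 => <-.
(* The multiplicity of w among the images of a. *)
pose c w := #|[pred i | e i a == w]|.
have cge w : w \in T -> (k <= c w)%N.
  rewrite -root_prod_XsubC -mT => wm.
  have [rs [urs srs rsP]] := extensions_above_root tgen pP mP aP wm.
  have -> : k = size rs by apply/eqP; rewrite -(eqn_pmul2r dgt) dE srs.
  have -> : c w = size [seq S`_(val i) | i <- enum [pred i : 'I_(\dim {:K}) | e i a == w]].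
    by rewrite size_map -cardE.
  apply: uniq_leq_size => // z zrs; have [zp zw] := rsP z zrs.
  move: zp; rewrite pS root_prod_XsubC; case/(nthP (0 : C)) => i; rewrite sS => iN iE.
  apply/mapP; exists (Ordinal iN) => //.
  by rewrite mem_enum inE eaE /ev /= iE zw.
have sumE (g : C -> C) : \sum_i g (e i a) = \sum_(w <- T) (c w)%:R * g w.
  transitivity (\sum_i \sum_(w <- T | w == e i a) g w).
    apply: eq_bigr => i _.
    by rewrite -big_filter filter_pred1_uniq // big_seq1.
  rewrite (exchange_big_dep predT) //=; apply: eq_bigr => w _.
  rewrite (eq_bigl [pred i | e i a == w]) => [|i]; last by rewrite /= eq_sym.
  by rewrite sumr_const mulr_natl.
(* Every multiplicity is at least k, and they add up to k times the number of conjugates. *)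
have cE w : w \in T -> c w = k.
  have : \sum_(w <- T) (c w)%:R = \sum_(w <- T) k%:R :> C.
    transitivity (\sum_(i < \dim {:K}) 1 : C).
      by rewrite (sumE (fun=> 1)); apply: eq_bigr => x _; rewrite mulr1.
    by rewrite sumr_const card_ord big_const_seq count_predT iter_addr_0 sT -mulrnA dE.
  move=> /eqP; rewrite -!natr_sum eqr_nat => /eqP cs wT.
  apply/eqP; rewrite eqn_leq cge // andbT.
  move: cs; rewrite !(bigD1_seq w) //= => cs.
  have : (\sum_(i <- T | i != w) k <= \sum_(i <- T | i != w) c i)%N.
    rewrite big_seq_cond [leqRHS]big_seq_cond.
    by apply: leq_sum => i /andP [/cge].
  by rewrite -(leq_add2l k) -cs leq_add2r.
rewrite sumE big_seq (eq_bigr (fun w => k%:R * f w)); last by move=> w /cE ->.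
by rewrite -big_seq -mulr_sumr mulrA -natrM mulnC dE.
Qed.

Lemma sum_embeddings (R : realType) (K : fieldExtType rat) (n : nat)
    (e : 'I_n -> {rmorphism K -> R[i]}) (F : (K -> R[i]) -> R[i]) :
  (forall i j, e i =1 e j -> i = j) ->
  (forall s : {rmorphism K -> R[i]}, exists i, s =1 e i) ->
  \sum_(s \in embeddings R K) F s = \sum_i F (e i).
Proof.
move=> einj esur.
pose r : seq (K -> R[i]) := [seq (e i : K -> R[i]) | i <- enum 'I_n].
have -> : embeddings R K = [set` r].
  apply/seteqP; split=> s /=.
    move=> [s' _ <-]; have [i ei] := esur s'.
    by apply/mapP; exists i; rewrite ?mem_enum //; apply/funext.
  by move=> /mapP [i _ ->]; exists (e i).
rewrite -fsbig_seq; last first.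
  rewrite map_inj_uniq ?enum_uniq // => i j eij; apply: einj => x.
  by rewrite eij.
by rewrite big_map big_enum.
Qed.

Definition rat_minpoly (a : algC) : {poly rat} := sval (minCpolyP a).
Lemma rat_minpolyP a : minCpoly a = map_poly ratr (rat_minpoly a) /\ rat_minpoly a \is monic.
Proof. by rewrite /rat_minpoly; case: (minCpolyP a). Qed.
Lemma root_rat_minpoly (a : algC) q : root (map_poly ratr q) a = (rat_minpoly a %| q).
Proof. by rewrite /rat_minpoly; case: (minCpolyP a). Qed.

Lemma rat_minpoly_incl (K : fieldExtType rat) (f : {rmorphism K -> algC}) (a : K) :
  is_rat_minpoly a (rat_minpoly (f a)).
Proof.
split; first by case: (rat_minpolyP (f a)).
move=> q; rewrite -root_rat_minpoly /root -rmorph_horner_rat.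
by rewrite fmorph_eq0.
Qed.

Lemma degreeE a : degree a = (size (rat_minpoly a)).-1.
Proof.
have [ga gen] := numfield_gensP [:: a].
move: ga gen; case: (numfield_gens _) => [|x [|y r]] //= [xa].
rewrite /degree => xgen.
have := rat_minpoly_incl (numfield_incl [:: a]) x.
by rewrite xa => /dim_adjoin_rat_minpoly <-; rewrite -xgen adjoin_seq1.
Qed.


(** Composing with complex conjugation permutes the embeddings. *)
Lemma sum_embeddings_real (C : numClosedFieldType) (K : fieldExtType rat) (n : nat)
    (e : 'I_n -> {rmorphism K -> C}) (a b : K) :
  (forall i j, e i =1 e j -> i = j) ->
  (forall s : {rmorphism K -> C}, exists i, s =1 e i) ->
  \sum_i (e i a * (e i b)^*) \is Num.real.
Proof.
move=> einj esur.
have [h hE] := fin_all_exists (fun i => esur (Num.conj \o e i : {rmorphism K -> C})).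
have hinj : injective h.
  move=> i j hij; apply: einj => x; apply: (inv_inj (@conjCK C)).
  by have := hE i x; rewrite hij -hE.
apply/CrealP; rewrite [RHS](reindex_inj hinj) rmorph_sum; apply: eq_bigr => i _ /=.
by rewrite -!hE /= rmorphM.
Qed.

(** Everything about [inner] that the counts use: it is a mean over an explicit finite family of
    embeddings, the sum is real, and means over this family are means over conjugates. *)
Lemma innerP (R : realType) (a b : algC) :
  exists (K : fieldExtType rat) (f : {rmorphism K -> algC}) (a' b' : K)
     (e : 'I_(\dim {:K}) -> {rmorphism K -> R[i]}),
  [/\ f a' = a, f b' = b,
      forall (c : K) (T : seq R[i]) (g : R[i] -> R[i]),
         map_poly ratr (rat_minpoly (f c)) = \prod_(w <- T) ('X - w%:P) ->
         (size (rat_minpoly (f c))).-1%:R * \sum_i g (e i c) =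
         (\dim {:K})%:R * \sum_(w <- T) g w,
      inner R a b = (\dim {:K})%:R^-1 * \sum_i (e i a' * (e i b')^*) &
      \sum_i (e i a' * (e i b')^*) \is Num.real].
Proof.
set K := numfield [:: a; b].
have [e [einj esur eP]] := embeddings_roots (R[i] : numClosedFieldType) K.
exists K, (numfield_incl [:: a; b]), (numfield_gens [:: a; b])`_0, (numfield_gens [:: a; b])`_1, e.
have [ga _] := numfield_gensP [:: a; b].
split.
- by move: ga; case: (numfield_gens _) => [|x s] //= [].
- by move: ga; case: (numfield_gens _) => [|x [|y s]] //= [].
- by move=> c T g; apply: eP; apply: rat_minpoly_incl.
- rewrite /inner; congr (_ * _).
  by rewrite (sum_embeddings _ einj esur).
- exact: sum_embeddings_real.
Qed.

(** * Small conjugates force indecomposability *)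

Lemma root_rat_minpoly_emb (C : numFieldType) (K : fieldExtType rat) (f : {rmorphism K -> algC})
    (s : {rmorphism K -> C}) (c : K) :
  root (map_poly ratr (rat_minpoly (f c))) (s c).
Proof.
rewrite /root -rmorph_horner_rat; have [_ P] := rat_minpoly_incl f c.
have /rootP -> : root (map_poly (in_alg K) (rat_minpoly (f c))) c by rewrite P.
by rewrite rmorph0.
Qed.

Lemma Aint_rat_minpoly (a : algC) : a \in Aint ->
  exists2 p : {poly int}, p \is monic & rat_minpoly a = map_poly intr p.
Proof.
rewrite unfold_in => aint; have [aE am] := rat_minpolyP a.
have : rat_minpoly a \is a polyOver (Num.int : {pred rat}).
  apply/polyOverP => i; have := polyOverP aint i; rewrite aE coef_map /=.
  by rewrite Cint_rat.
move=> /floorpP [p pE]; exists p => //.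
move: am; rewrite pE !monicE (lead_coef_map_inj (@intr_inj rat)) ?rmorph0 //.
by rewrite -(rmorph1 (intr : int -> rat)) eqr_int.
Qed.

Lemma map_ratr_intr (F : numFieldType) (p : {poly int}) :
  map_poly (ratr : rat -> F) (map_poly intr p) = map_poly intr p.
Proof. by rewrite -map_poly_comp; apply: eq_map_poly => x; rewrite /= ratr_int. Qed.

Lemma rat_minpoly_gt1 (a : algC) : (1 < size (rat_minpoly a))%N.
Proof.
have [aE _] := rat_minpolyP a.
by rewrite -(size_map_poly (ratr : {rmorphism rat -> algC})) -aE size_minCpoly.
Qed.

(** Otherwise X would split off the minimal polynomial, leaving a smaller one. *)
Lemma rat_minpoly_const_neq0 (a : algC) : a != 0 -> (rat_minpoly a)`_0 != 0.
Proof.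
move=> a0; apply/eqP => c0.
have : 'X - 0%:P %| rat_minpoly a by rewrite dvdp_XsubCl rootE horner_coef0 c0.
case/dvdpP=> g; rewrite subr0 => gE.
have gn0 : g != 0.
  by apply/eqP => g0; have := rat_minpoly_gt1 a; rewrite gE g0 mul0r size_poly0.
have : root (map_poly ratr (rat_minpoly a)) a by rewrite root_rat_minpoly.
rewrite gE rmorphM /= map_polyX rootM [root 'X a]rootE hornerX (negPf a0) orbF.
rewrite root_rat_minpoly => /(dvdp_leq gn0).
by rewrite gE size_mulX // ltnn.
Qed.

Lemma norm_int_ge1 (F : numDomainType) (z : int) : z != 0 -> 1 <= `|z%:~R : F|.
Proof.
move=> z0; rewrite -intr_norm (ler_int F 1).
by rewrite -[_ <= _]/(0 < `|z|) normr_gt0.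
Qed.

(** The product of the conjugates is, up to sign, the constant coefficient of the minimal polynomial,
    a nonzero integer. *)
Lemma prod_conjugates_ge1 (C : numClosedFieldType) (a : algC) (T : seq C) :
  a \in Aint -> a != 0 -> map_poly ratr (rat_minpoly a) = \prod_(w <- T) ('X - w%:P) ->
  1 <= \prod_(w <- T) `|w| ^+ 2.
Proof.
move=> aint a0 aT.
have [p pm pE] := Aint_rat_minpoly aint.
have p0 : p`_0 != 0.
  by have := rat_minpoly_const_neq0 a0; rewrite pE coef_map /= intr_eq0.
suff E : \prod_(w <- T) `|w| = `|(p`_0)%:~R| :> C.
  by rewrite prodrXl E exprn_ege1 // norm_int_ge1.
rewrite -normr_prod.
have := congr1 (fun q => `|q.[0]|) aT; rewrite pE map_ratr_intr horner_coef0 coef_map /= => ->.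
rewrite horner_prod !normr_prod; apply: eq_bigr => w _.
by rewrite hornerXsubC sub0r normrN.
Qed.

Lemma size_conjugates (C : numClosedFieldType) (a : algC) (T : seq C) :
  map_poly ratr (rat_minpoly a) = \prod_(w <- T) ('X - w%:P) -> size T = (size (rat_minpoly a)).-1.
Proof.
by move=> aT; rewrite -(size_map_poly (ratr : {rmorphism rat -> C})) aT size_prod_XsubC.
Qed.

Lemma AGM_seq (F : numFieldType) (T : seq F) :
  (forall w, w \in T -> 0 <= w) ->
  \prod_(w <- T) w <= ((\sum_(w <- T) w) / (size T)%:R) ^+ size T.
Proof.
move=> T0.
have H : {in predT, forall i : 'I_(size T), 0 <= T`_i} by move=> i _; apply/T0/mem_nth.
have /= [+ _] := leif_AGM H; rewrite card_ord => {}H.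
by rewrite !(big_nth (0 : F)) !big_mkord.
Qed.

(** The product of the squares is at least 1 ([prod_conjugates_ge1]), hence so is their mean, by the
    inequality between arithmetic and geometric means. *)
Lemma sum_conjugates_ge (C : numClosedFieldType) (a : algC) (T : seq C) :
  a \in Aint -> a != 0 -> map_poly ratr (rat_minpoly a) = \prod_(w <- T) ('X - w%:P) ->
  (size T)%:R <= \sum_(w <- T) `|w| ^+ 2.
Proof.
move=> aint a0 aT.
have sT : (0 < size T)%N.
  by rewrite (size_conjugates aT) -ltnS prednK ?rat_minpoly_gt1 // ltnW ?rat_minpoly_gt1.
have := prod_conjugates_ge1 aint a0 aT.
have := @AGM_seq C [seq `|w| ^+ 2 | w <- T].
rewrite !big_map size_map => H H2.
have {}H : 1 <= ((\sum_(w <- T) `|w| ^+ 2) / (size T)%:R) ^+ size T.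
  by apply: le_trans H2 (H _) => w /mapP [x _ ->]; rewrite exprn_ge0.
have sTR : 0 < (size T)%:R :> C by rewrite ltr0n.
rewrite -[leLHS]mul1r -ler_pdivlMr //; rewrite -(ler_pXn2r sT) ?nnegrE ?ler01 ?expr1n //.
by rewrite divr_ge0 ?ler0n // sumr_ge0 // => w _; rewrite exprn_ge0.
Qed.

Lemma conjugates_exist (C : numClosedFieldType) (a : algC) :
  exists T : seq C, map_poly ratr (rat_minpoly a) = \prod_(w <- T) ('X - w%:P).
Proof.
have [T aT] := closed_field_poly_normal (map_poly (ratr : rat -> C) (rat_minpoly a)).
exists T; move: aT; rewrite (monicP _) ?scale1r //.
by rewrite map_monic; have [_] := rat_minpolyP a.
Qed.

(** If a = b + c with <b, c> >= 0, the mean squares satisfy q(a) >= q(b) + q(c), and this is at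
    least 2 as soon as b and c are nonzero. *)
Lemma indecomposable_of_small_conjugates (R : realType) (a : algC) :
  a \in Aint -> a != 0 ->
  (forall w : R[i], root (map_poly ratr (rat_minpoly a)) w -> `|w| ^+ 2 < 2) ->
  indecomposable R a.
Proof.
move=> aint a0 small; split=> // b c [bint cint abc].
have [b0|b0] := eqVneq b 0; first by right; rewrite abc b0 add0r.
have [c0|c0] := eqVneq c 0; first by left; rewrite abc c0 addr0.
have [K [f [b' [c' [e [fb fc eP -> S_real]]]]]] := innerP R b c.
have N0 : 0 < (\dim {:K})%:R :> R[i] by rewrite ltr0n adim_gt0.
rewrite pmulr_rge0 ?invr_gt0 //; set S := \sum_i _ => S0.
have big (x : K) : f x \in Aint -> f x != 0 -> (\dim {:K})%:R <= \sum_i `|e i x| ^+ 2 :> R[i].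
  move=> xint x0; have [T xT] := conjugates_exist R[i] (f x).
  have d0 : 0 < (size (rat_minpoly (f x))).-1%:R :> R[i].
    by rewrite ltr0n -ltnS prednK ?rat_minpoly_gt1 // ltnW ?rat_minpoly_gt1.
  rewrite -(ler_pM2l d0) (eP x T (fun w => `|w| ^+ 2) xT) mulrC ler_pM2l //.
  by rewrite -(size_conjugates xT) (sum_conjugates_ge xint x0 xT).
have : \sum_i `|e i (b' + c')| ^+ 2 < \sum_(i < \dim {:K}) 2 :> R[i].
  apply: ltr_sum => [|i _].
    by apply/hasP; exists (Ordinal (adim_gt0 {:K}%AS)); rewrite ?mem_index_enum.
  by apply: small; have := root_rat_minpoly_emb f (e i) (b' + c'); rewrite rmorphD fb fc -abc.
have -> : \sum_i `|e i (b' + c')| ^+ 2 = \sum_i `|e i b'| ^+ 2 + \sum_i `|e i c'| ^+ 2 + (S + S^*).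
  rewrite rmorph_sum -!big_split; apply: eq_bigr => i _ /=.
  rewrite !normCK !rmorphD !rmorphM /= conjCK; ring.
rewrite sumr_const card_ord => /lt_geF/negP [].
rewrite -[2 *+ _]mulr_natr mulrDl !mul1r -[leLHS]addr0.
apply: lerD; first by apply: lerD; apply: big; rewrite ?fb ?fc.
by rewrite addr_ge0 // conjC_ge0.
Qed.

(** * Algebraic integers close to half of a given one *)

(** Outside the disc of radius r the leading term dominates.  Serves twice: to locate the roots of
    the polynomial that decomposes a given integer, and those of the Eisenstein polynomials. *)
Lemma root_norm_lt (F : numFieldType) (y r : F) (m n : nat) (c : nat -> F) :
  (n <= m)%N -> 0 < r -> \sum_(k < n) `|c k| * r ^+ k < r ^+ m ->
  y ^+ m + \sum_(k < n) c k * y ^+ k = 0 -> `|y| < r.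
Proof.
move=> nm r0 small y0; rewrite real_ltNge ?normr_real ?gtr0_real //; apply/negP => ry.
have ygt : 0 < `|y| by apply: lt_le_trans ry.
have r0w := ltW r0; have ygw := ltW ygt.
have yE : `|y| ^+ m <= \sum_(k < n) `|c k| * `|y| ^+ k.
  have -> : `|y| ^+ m = `|\sum_(k < n) c k * y ^+ k|.
    by rewrite -normrX -[RHS]normrN; congr `|_|; apply/eqP; rewrite -subr_eq0 opprK y0.
  apply: le_trans (ler_norm_sum _ _ _) _.
  by apply: ler_sum => k _; rewrite normrM normrX.
have : r ^+ m * `|y| ^+ m <= (\sum_(k < n) `|c k| * r ^+ k) * `|y| ^+ m.
  apply: le_trans (_ : r ^+ m * \sum_(k < n) `|c k| * `|y| ^+ k <= _).
    by rewrite ler_wpM2l ?exprn_ge0.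
  rewrite mulr_sumr mulr_suml; apply: ler_sum => k _.
  have km : (k <= m)%N by apply: leq_trans nm; apply: ltnW.
  rewrite mulrCA -mulrA ler_wpM2l ?normr_ge0 // -(subnK km) !exprD.
  rewrite -[leLHS]mulrA [leRHS]mulrCA ler_wpM2r ?mulr_ge0 ?exprn_ge0 //.
  by rewrite lerXn2r ?nnegrE.
rewrite ler_pM2r ?exprn_gt0 //.
by move/(lt_le_trans small); rewrite ltxx.
Qed.

(** Elements of Q[Y] stand for the elements of Q(a) and are evaluated at all the conjugates of a at
    once, so that polynomials over Q(a) can be handled as elements of Q[Y][X]. *)
Definition eval_at (F : numFieldType) (y : F) (r : {poly rat}) : F := (map_poly ratr r).[y].

Fact eval_at_is_zmod (F : numFieldType) (y : F) : zmod_morphism (eval_at y).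
Proof. by move=> r s; rewrite /eval_at rmorphB hornerD hornerN. Qed.
Fact eval_at_is_monoid (F : numFieldType) (y : F) : monoid_morphism (eval_at y).
Proof. by split=> [|r s]; rewrite /eval_at ?rmorph1 ?hornerC // rmorphM hornerM. Qed.
HB.instance Definition _ (F : numFieldType) (y : F) :=
  GRing.isZmodMorphism.Build _ _ (eval_at y) (eval_at_is_zmod y).
HB.instance Definition _ (F : numFieldType) (y : F) :=
  GRing.isMonoidMorphism.Build _ _ (eval_at y) (eval_at_is_monoid y).

Lemma eval_at_poly (F : numFieldType) (y : F) d (E : nat -> rat) :
  eval_at y (\poly_(j < d) E j) = \sum_(j < d) ratr (E j) * y ^+ j.
Proof.
rewrite poly_def rmorph_sum; apply: eq_bigr => j _.
by rewrite /= /eval_at map_polyZ map_polyXn hornerZ hornerXn.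
Qed.

(** Rounding in Q(a): write r(a) in the basis of powers of a and replace each rational coordinate
    by its integer part.  The error is bounded at every conjugate, uniformly in r. *)
Lemma round_coef (C : numClosedFieldType) (a : algC) : a \in Aint ->
  exists2 B : C, 0 <= B & forall r : {poly rat}, exists2 c : {poly rat},
  eval_at a (r + c) \in Aint &
  forall w : C, root (map_poly ratr (rat_minpoly a)) w -> `|eval_at w c| <= B.
Proof.
move=> aint; have [T aT] := conjugates_exist C a.
pose d := size (rat_minpoly a).
have B0 w : 0 <= \sum_(j < d) `|w| ^+ j :> C by rewrite sumr_ge0 // => j _; rewrite exprn_ge0.
exists (\sum_(w <- T) \sum_(j < d) `|w| ^+ j); first by rewrite sumr_ge0.
move=> r; pose s := r %% rat_minpoly a.
have sd : (size s <= d)%N.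
  by apply/ltnW; rewrite ltn_modp; case: (rat_minpolyP a) => _ /monic_neq0.
exists (\poly_(j < d) ((Num.floor s`_j)%:~R - s`_j)).
  rewrite [r](divp_eq _ (rat_minpoly a)) -/s -addrA rmorphD rmorphM /=.
  have -> : eval_at a (rat_minpoly a) = 0 by apply/rootP; rewrite root_rat_minpoly.
  rewrite mulr0 add0r.
  have -> : s + \poly_(j < d) ((Num.floor s`_j)%:~R - s`_j) = \poly_(j < d) (Num.floor s`_j)%:~R.
    apply/polyP => i; rewrite coefD !coef_poly; case: ltnP => [_|di]; first by rewrite addrC subrK.
    by rewrite addr0 nth_default // (leq_trans sd).
  rewrite eval_at_poly rpred_sum // => j _.
  by rewrite rmorph_int rpredM ?rpredX // Aint_int.
move=> w; rewrite aT root_prod_XsubC => wT.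
rewrite eval_at_poly.
apply: le_trans (ler_norm_sum _ _ _) _.
apply: le_trans (_ : \sum_(j < d) `|w| ^+ j <= _); last first.
  by rewrite (big_rem w) //= lerDl sumr_ge0.
apply: ler_sum => j _; rewrite normrM normrX ler_piMl ?exprn_ge0 //.
have /andP [f1 f2] := floor_itv s`_j.
rewrite rmorphB /= rmorph_int distrC -(rmorph_int ratr) -rmorphB /= ger0_norm.
  by rewrite -[leRHS](rmorph1 (ratr : {rmorphism rat -> C})) ler_rat lerBlDl ltW //
             -[X in _ + X]/(1%:~R) -intrD.
by rewrite -[leLHS](rmorph0 (ratr : {rmorphism rat -> C})) ler_rat subr_ge0.
Qed.

(** X - Y/2, whose powers form a basis adapted to the discs around the halves of the conjugates. *)
Definition shiftX : {poly {poly rat}} := 'X - (2^-1 *: 'X)%:P.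

(** The shifted powers are monic, so the coefficients can be made integral from the top down:
    correcting in degree k by a multiple of the k-th shifted power leaves higher degrees alone. *)
Lemma round_poly (C : numClosedFieldType) (a : algC) (B : C) :
  (forall r : {poly rat}, exists2 c : {poly rat}, eval_at a (r + c) \in Aint &
    forall w : C, root (map_poly ratr (rat_minpoly a)) w -> `|eval_at w c| <= B) ->
  forall n (g : {poly {poly rat}}), exists c : nat -> {poly rat},
    (forall k (w : C), root (map_poly ratr (rat_minpoly a)) w -> `|eval_at w (c k)| <= B) /\
    (forall j, (j < n)%N -> eval_at a (g + \sum_(k < n) c k *: shiftX ^+ k)`_j \in Aint).
Proof.
move=> rnd; elim=> [|n IH] g.
  have [c _ cB] := rnd 0; exists (fun=> c); split=> // k; exact: cB.
have [cn cnint cnB] := rnd g`_n.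
have [c [cB cint]] := IH (g + cn *: shiftX ^+ n).
exists (fun k => if k == n then cn else c k); split.
  by move=> k w wr; case: ifP => _; [apply: cnB | apply: cB].
move=> j; rewrite ltnS leq_eqVlt big_ord_recr /= eqxx.
under eq_bigr => i _ do rewrite ltn_eqF //.
rewrite addrCA addrC; case/predU1P => [->|/cint //].
have szT k : size (shiftX ^+ k) = k.+1 by rewrite size_exp_XsubC.
rewrite !coefD coef_sum big1 => [|i _]; last first.
  by rewrite coefZ nth_default ?mulr0 // szT.
have /monicP : shiftX ^+ n \is monic by rewrite monic_exp // monicXsubC.
by rewrite coefZ /lead_coef szT /= => ->; rewrite mulr1 addr0.
Qed.

Lemma eval_at_halfX (F : numFieldType) (y : F) : eval_at y (2^-1 *: 'X) = y / 2.
Proof. by rewrite /eval_at map_polyZ map_polyX hornerZ hornerX fmorphV rmorph_nat mulrC. Qed.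

(** Fekete's device: if the exponent m is highly divisible, the top coefficients of (X - a/2)^m are
    already integral, because 2^k divides the binomial coefficient of m over k for k <= k0. *)
Lemma shiftX_coef_Aint (a : algC) (k0 j : nat) : let m := (2 ^ k0 * k0`!)%N in
  a \in Aint -> (m <= j + k0)%N -> eval_at a ((shiftX ^+ m)`_j) \in Aint.
Proof.
move=> m aint mj; case: (ltnP m j) => [mj2|jm].
  by rewrite nth_default ?rmorph0 ?Aint0 // size_exp_XsubC.
have E i : (-1) ^+ i * 'X^(m - i) * (2^-1 *: 'X)%:P ^+ i =
    ((-1) ^+ i * (2^-1 *: 'X) ^+ i) *: 'X^(m - i) :> {poly {poly rat}}.
  by rewrite -[RHS]mul_polyC polyCM !polyC_exp polyCN mulrAC.
rewrite /shiftX exprBn coef_sum (bigD1 (Ordinal (leq_subr j m : m - j < m.+1)%N)) //=.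
rewrite big1 ?addr0 => [|i ine].
  have kk0 : (m - j <= k0)%N by rewrite leq_subLR.
  have : (2 ^ (m - j) %| 'C(m, m - j))%N.
    case: (m - j)%N kk0 => [|k] kk0; first by rewrite expn0 dvd1n.
    have := mul_bin_diag m k; rewrite {1}/m.
    have /dvdnP [q ->] : (k.+1 %| k0`!)%N by rewrite dvdn_fact.
    rewrite mulnA -mulnA mulnC -mulnA => /eqP; rewrite eqn_pmul2l // => /eqP <-.
    by rewrite mulnC -mulnA dvdn_mulr // dvdn_exp2l.
  case/dvdnP => q ->; set k := (m - j)%N.
  rewrite coefMn E coefZ coefXn subKn // eqxx mulr1 rmorphMn rmorphM !rmorphXn /= rmorphN1 eval_at_halfX.
  rewrite exprMn exprVn -mulr_natr natrM natrX -mulrA mulrACA.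
  rewrite mulVf ?expf_neq0 ?pnatr_eq0 // mulr1.
  by rewrite !rpredM ?rpredX ?rpredN ?Aint1 // Aint_Cnat // natr_nat.
rewrite coefMn E coefZ coefXn; case: eqP => [jE|_]; last by rewrite mulr0 mul0rn.
case/eqP: ine; apply: val_inj; rewrite /= jE subKn //.
by rewrite -ltnS.
Qed.

Lemma Aint_integralOver (x : algC) : x \in Aint <-> integralOver (intr : int -> algC) x.
Proof.
split=> [xint|[p pm px]].
  have [p pm pE] := Aint_rat_minpoly xint; exists p => //.
  by rewrite -map_ratr_intr -pE root_rat_minpoly.
apply: root_monic_Aint px _ _; first exact: monic_map.
by apply/polyOverP => i; rewrite coef_map /= intr_int.
Qed.

(** Transitivity of integrality. *)
Lemma Aint_monic_root (p : {poly algC}) (x : algC) :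
  p \is monic -> (forall j, p`_j \in Aint) -> root p x -> x \in Aint.
Proof.
move=> pm pint px; apply/Aint_integralOver; rewrite -[x]hornerX.
apply: (@integral_horner_root _ _ (intr : {rmorphism int -> algC}) x p 'X pm px).
  by move=> c /(nthP 0) [j _ <-]; apply/Aint_integralOver.
by move=> c /(nthP 0) [j _ <-]; apply/Aint_integralOver; rewrite coefX; case: eqP; rewrite ?Aint0 ?Aint1.
Qed.

(** The constructive part of a Fekete-Szego theorem, for discs of one radius r > 1 around the
    halves of the conjugates of a.  Perturb (X - a/2)^m into a polynomial with integral
    coefficients without touching its top k0 coefficients ([shiftX_coef_Aint], [round_poly]).
    The perturbation is at most B (1 + r + ... + r^(m - k0 - 1)) on the circle, which is less than
    r^m once B < (r - 1) r^k0, so all the roots stay in the discs. *)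
Lemma Aint_near_half (C : numClosedFieldType) (a : algC) (r : C) :
  a \in Aint -> 1 < r -> (forall x : C, 0 <= x -> exists k, x < (r - 1) * r ^+ k) ->
  exists (b : algC) (G : {poly {poly rat}}),
    [/\ b \in Aint, root (map_poly (eval_at a) G) b &
        forall w y : C, root (map_poly ratr (rat_minpoly a)) w -> root (map_poly (eval_at w) G) y ->
        `|y - w / 2| < r].
Proof.
move=> aint r1 arch.
have [B B0 rnd] := round_coef C aint.
have [k0 Bk0] := arch B B0.
(* The exponent for which the top k0 coefficients need no correction. *)
pose m := (2 ^ k0 * k0`!)%N.
have k0m : (k0 <= m)%N.
  by apply: leq_trans (ltnW (ltn_expl k0 (ltnSn 1))) _; rewrite leq_pmulr ?fact_gt0.
have m0 : (0 < m)%N by rewrite muln_gt0 expn_gt0 fact_gt0.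
pose n := (m - k0)%N; have nm : (n <= m)%N by rewrite leq_subr.
have [c [cB cint]] := round_poly rnd n (shiftX ^+ m).
set G := _ + _ in cint.
pose S := \sum_(k < n) c k *: shiftX ^+ k.
have szS : (size S <= n)%N.
  apply: leq_trans (size_sum _ _ _) _; apply/bigmax_leqP => k _.
  by apply: leq_trans (size_scale_leq _ _) _; rewrite size_exp_XsubC.
have Gint j : eval_at a G`_j \in Aint.
  have [/cint //|nj] := ltnP j n.
  rewrite coefD -/S (nth_default _ (leq_trans szS nj)) addr0.
  by apply: shiftX_coef_Aint => //; rewrite -/m addnC -leq_subLR.
have szT : size (shiftX ^+ m) = m.+1 by rewrite size_exp_XsubC.
have szG : size G = m.+1 by rewrite size_polyDl szT // ltnS (leq_trans szS).
have Gm : G \is monic.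
  rewrite monicE lead_coefDl ?szT ?ltnS ?(leq_trans szS) //.
  by rewrite -monicE monic_exp // monicXsubC.
have GEm : map_poly (eval_at a) G \is monic by exact: monic_map.
have : size (map_poly (eval_at a) G) != 1%N.
  by rewrite size_map_poly_id0 ?szG ?(monicP Gm) ?rmorph1 ?oner_eq0 // eqSS -lt0n.
case/closed_rootP => b bG; exists b, G; split=> //.
  by apply: Aint_monic_root GEm _ bG => j; rewrite coef_map; apply: Gint.
have r0 : 0 < r by apply: lt_trans r1.
move=> w y wa; rewrite rootE.
have TE k : (map_poly (eval_at w) (shiftX ^+ k)).[y] = (y - w / 2) ^+ k.
  by rewrite rmorphXn horner_exp rmorphB /= map_polyX map_polyC /= eval_at_halfX hornerXsubC.
have -> : (map_poly (eval_at w) G).[y] =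
    (y - w / 2) ^+ m + \sum_(k < n) eval_at w (c k) * (y - w / 2) ^+ k.
  rewrite rmorphD hornerD /= TE rmorph_sum horner_sum; congr (_ + _).
  by apply: eq_bigr => k _; rewrite /= map_polyZ hornerZ /= TE.
move=> /eqP; apply: (@root_norm_lt C (y - w / 2) r m n (fun k => eval_at w (c k))) => //.
apply: le_lt_trans (_ : B * \sum_(k < n) r ^+ k < _).
  rewrite mulr_sumr; apply: ler_sum => k _; rewrite ler_wpM2r ?exprn_ge0 ?(ltW r0) //. exact: cB.
have r10 : 0 < r - 1 by rewrite subr_gt0.
rewrite -(ltr_pM2l r10) mulrCA -subrX1.
apply: le_lt_trans (_ : B * r ^+ n < _).
  by rewrite ler_wpM2l // lerBlDr lerDl.
by rewrite -(subnKC k0m) exprD mulrA ltr_pM2r ?exprn_gt0.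
Qed.

(** * An indecomposable has mean square conjugate at most 4 *)

(** Both sides read the same relation between x and y in K, through f and through s. *)
Lemma root_eval_at_emb (F : numFieldType) (K : fieldExtType rat) (f : {rmorphism K -> algC})
    (s : {rmorphism K -> F}) (x y : K) (G : {poly {poly rat}}) :
  root (map_poly (eval_at (f x)) G) (f y) -> root (map_poly (eval_at (s x)) G) (s y).
Proof.
pose g : {rmorphism {poly rat} -> K} := horner_eval x \o map_poly (in_alg K).
have E (F' : numFieldType) (s' : {rmorphism K -> F'}) :
    map_poly (eval_at (s' x)) G = map_poly s' (map_poly g G).
  rewrite -map_poly_comp; apply: eq_map_poly => r /=.
  by rewrite horner_evalE rmorph_horner_rat.
by rewrite !E !fmorph_root.
Qed.

(** Bernoulli's inequality r^k - 1 >= k (r - 1) and the archimedean property. *)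
Lemma exp_unbounded (R : realType) (r : R[i]) : 1 < r ->
  forall x, 0 <= x -> exists k, x < (r - 1) * r ^+ k.
Proof.
move=> r1 x x0; have r10 : 0 < r - 1 by rewrite subr_gt0.
pose z := x / (r - 1) ^+ 2.
have z0 : 0 <= z by rewrite divr_ge0 // exprn_ge0 // ltW.
have /complex_realP [z' zE] : z \is Num.real by rewrite ger0_real.
exists (Num.bound z').
have zk : z < (Num.bound z')%:R.
  rewrite zE -(rmorph_nat (real_complex R)) ltcR.
  by apply: archi_boundP; rewrite -(lecR 0) -zE.
have xE : x = (r - 1) * ((r - 1) * z).
  by rewrite /z mulrA -expr2 mulrC divfK // expf_neq0 // gt_eqF.
rewrite xE ltr_pM2l //; apply: le_lt_trans (_ : r ^+ Num.bound z' - 1 < _);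
  last by rewrite ltrBlDr ltrDl.
rewrite subrX1 ler_wpM2l ?(ltW r10) //; apply: le_trans (ltW zk) _.
rewrite -[X in X%:R]card_ord -sumr_const; apply: ler_sum => i _.
by rewrite exprn_ege1 // ltW.
Qed.

(** Read at one embedding, with a = 2u and b = u + y, this says that 2 Re <b, a - b> =
    2 (|a|^2 / 4 - |b - a/2|^2): being a decomposition means lying in a ball around a/2. *)
Lemma polarization (C : numClosedFieldType) (u y : C) :
  (u + y) * (u - y)^* + ((u + y) * (u - y)^*)^* = 2 * (4^-1 * `|u *+ 2| ^+ 2 - `|y| ^+ 2).
Proof.
rewrite !normCK !rmorphM /= !rmorphMn !rmorphB !rmorphD /= !conjCK; field; done.
Qed.

(** If the mean square q of the conjugates of a exceeds 4, then r = sqrt q / 2 > 1 and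
    [Aint_near_half] gives an integer b at distance less than r from a/2 under every embedding.
    By [polarization] the inner product of b and a - b is positive, so that (b, a - b) is a
    decomposition of a, and neither part can be 0. *)
Lemma sum_conjugates_le4 (R : realType) (a : algC) (T : seq R[i]) :
  indecomposable R a -> map_poly ratr (rat_minpoly a) = \prod_(w <- T) ('X - w%:P) ->
  \sum_(w <- T) `|w| ^+ 2 <= 4 * (size T)%:R.
Proof.
move=> [aint a0 indec] aT.
have d0 : 0 < (size T)%:R :> R[i].
  by rewrite ltr0n (size_conjugates aT) -ltnS prednK ?rat_minpoly_gt1 // ltnW ?rat_minpoly_gt1.
have T0 : 0 <= \sum_(w <- T) `|w| ^+ 2 by rewrite sumr_ge0 // => w _; rewrite exprn_ge0.
rewrite real_leNgt ?ger0_real // ?mulr_ge0 ?ler0n //; apply/negP => big.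
pose r : R[i] := sqrtC ((\sum_(w <- T) `|w| ^+ 2) / (4 * (size T)%:R)).
have r2 : r ^+ 2 = (\sum_(w <- T) `|w| ^+ 2) / (4 * (size T)%:R) by rewrite sqrtCK.
have d4 : 0 < 4 * (size T)%:R :> R[i] by rewrite mulr_gt0 // ltr0n.
have r1 : 1 < r.
  have rge : 0 <= r by rewrite sqrtC_ge0 divr_ge0 // ltW.
  by rewrite -(@ltr_pXn2r _ 2) ?nnegrE ?ler01 // r2 expr1n ltr_pdivlMr // mul1r.
have [b [G [bint bG Gr]]] := Aint_near_half aint r1 (exp_unbounded r1).
pose c := a - b.
have cint : c \in Aint by rewrite rpredB.
have [K [f [b' [c' [e [fb fc eP iE S_real]]]]]] := innerP R b c.
have fbc : f (b' + c') = a by rewrite rmorphD fb fc addrC subrK.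
set S := \sum_i _ in iE S_real.
have N0 : 0 < (\dim {:K})%:R :> R[i] by rewrite ltr0n adim_gt0.
pose u i := e i (b' + c') / 2; pose y i := e i b' - u i.
have yr i : `|y i| < r.
  apply: Gr; first by have := root_rat_minpoly_emb f (e i) (b' + c'); rewrite fbc.
  by apply: (root_eval_at_emb (f := f)); rewrite fbc fb.
have Q : \sum_i `|e i (b' + c')| ^+ 2 = (\dim {:K})%:R * (4 * r ^+ 2).
  have := eP (b' + c') T (fun w => `|w| ^+ 2); rewrite fbc => /(_ aT).
  rewrite -(size_conjugates aT) => H; apply: (mulfI (lt0r_neq0 d0)); rewrite H r2.
  field; rewrite lt0r_neq0 //.
have SS : S + S^* = 2 * \sum_i (r ^+ 2 - `|y i| ^+ 2).
  rewrite sumrB [X in 2 * (X - _)]sumr_const card_ord -[_ *+ \dim _]mulr_natl.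
  have -> : (\dim {:K})%:R * r ^+ 2 = 4^-1 * \sum_i `|e i (b' + c')| ^+ 2.
    by rewrite Q [RHS]mulrCA mulKf // pnatr_eq0.
  rewrite mulr_sumr -sumrB mulr_sumr rmorph_sum -big_split; apply: eq_bigr => i _ /=.
  have cE : e i c' = u i - y i by rewrite /y opprB addrA /u -splitr rmorphD addrC addKr.
  have bE : e i b' = u i + y i by rewrite /y addrC subrK.
  have -> : e i (b' + c') = u i *+ 2 by rewrite /u -mulr_natr divfK ?pnatr_eq0.
  by rewrite cE bE polarization.
have S0 : 0 < S.
  have : 0 < S + S^*.
    rewrite SS mulr_gt0 // sumrB subr_gt0; apply: ltr_sum => [|i _].
      by apply/hasP; exists (Ordinal (adim_gt0 {:K}%AS)); rewrite ?mem_index_enum.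
    by rewrite ltr_pXn2r ?nnegrE // ltW // (lt_trans ltr01).
  by rewrite (CrealP S_real) -mulr2n pmulrn_lgt0.
have ipos : 0 < inner R b c by rewrite iE mulr_gt0 // invr_gt0.
have neq0 (x : K) : f x = 0 -> x = 0 by move=> /eqP; rewrite fmorph_eq0 => /eqP.
have [] := indec b c.
- by split; rewrite ?(ltW ipos) // addrC subrK.
- case=> _ c0; move: S0; rewrite /S big1 ?ltxx // => i _.
  by rewrite (neq0 c') ?fc // !rmorph0 mulr0.
- case=> b0 _; move: S0; rewrite /S big1 ?ltxx // => i _.
  by rewrite (neq0 b') ?fb // !rmorph0 mul0r.
Qed.

(** * Integer polynomials whose roots have small mean square *)

Definition coef_dom (F : numDomainType) (p q : {poly F}) := forall j, `|p`_j| <= q`_j.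

(** Replacing each root by minus its modulus can only enlarge the coefficients. *)
Lemma coef_dom_prod (F : numDomainType) (T : seq F) :
  coef_dom (\prod_(w <- T) ('X - w%:P)) (\prod_(w <- T) ('X + `|w|%:P)).
Proof.
elim/big_rec2: _ => [|w p q _ pq] j.
  by rewrite !coef1; case: eqP => _; rewrite ?normr1 ?normr0.
rewrite !coefM; apply: le_trans (ler_norm_sum _ _ _) _.
apply: ler_sum => i _; rewrite normrM; apply: ler_pM; rewrite ?normr_ge0 //.
rewrite coefB coefD !coefX !coefC.
by case: (val i) => [|[|k]] /=; rewrite ?sub0r ?add0r ?subr0 ?addr0 ?normrN ?normr1 ?normr0.
Qed.

(** A nonnegative coefficient times t^j is at most the value at t, and by the inequality between
    arithmetic and geometric means the product of the t + |w| is at most (t + mean)^n. *)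
Lemma coef_prod_XsubC_le (F : numFieldType) (T : seq F) (j : nat) (t : F) :
  0 <= t -> \sum_(w <- T) `|w| <= 2 * (size T)%:R ->
  `|(\prod_(w <- T) ('X - w%:P))`_j| * t ^+ j <= (t + 2) ^+ size T.
Proof.
move=> t0 T2.
have [n0|n0] := posnP (size T).
  rewrite (size0nil n0) big_nil coef1 /=; case: eqP => [->|_]; first by rewrite normr1 mul1r !expr0.
  by rewrite normr0 mul0r expr0 ler01.
set Q := \prod_(w <- T) ('X + `|w|%:P).
have dom := coef_dom_prod T.
have Q0 i : 0 <= Q`_i by apply: le_trans (dom i).
apply: le_trans (_ : Q`_j * t ^+ j <= _); first by rewrite ler_wpM2r ?exprn_ge0 // dom.
apply: le_trans (_ : Q.[t] <= _).
  rewrite (@horner_coef_wide _ (maxn (size Q) j.+1)) ?leq_maxl //.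
  have jm : (j < maxn (size Q) j.+1)%N by rewrite leq_maxr.
  rewrite (bigD1 (Ordinal jm)) //= lerDl sumr_ge0 // => i _.
  by rewrite mulr_ge0 ?exprn_ge0.
rewrite /Q horner_prod.
rewrite (eq_bigr (fun w => t + `|w|)) => [|w _]; last by rewrite hornerD hornerX hornerC.
have := @AGM_seq F [seq t + `|w| | w <- T]; rewrite !big_map size_map => H.
apply: le_trans (H _) _; first by move=> w /mapP [x _ ->]; rewrite addr_ge0.
have sT : 0 < (size T)%:R :> F by rewrite ltr0n.
rewrite lerXn2r ?nnegrE ?divr_ge0 ?addr_ge0 // ?sumr_ge0 // => [w _|]; first by rewrite addr_ge0.
rewrite ler_pdivrMr // big_split /= big_const_seq count_predT iter_addr_0 mulrDl mulr_natr lerD2l //.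
Qed.

(** The bound of [coef_prod_XsubC_le] at its optimal point t = 2j / (n - j).  After
    division it is 2^(n - j) times the binomial coefficient of n over j, up to a factor polynomial
    in n. *)
Lemma coef_entropy_bound (F : numFieldType) (T : seq F) (n j : nat) :
  size T = n -> (j < n)%N -> \sum_(w <- T) `|w| <= 2 * n%:R ->
  `|(\prod_(w <- T) ('X - w%:P))`_j| * (j ^ j * (n - j) ^ (n - j))%:R <= (2 ^ (n - j) * n ^ n)%:R.
Proof.
move=> sT jn T2.
have nj : 0 < (n - j)%:R :> F by rewrite ltr0n subn_gt0.
have t0 : 0 <= (2 * j)%:R / (n - j)%:R :> F by rewrite divr_ge0.
have := @coef_prod_XsubC_le F T j _ t0; rewrite sT => /(_ T2).
have -> : (2 * j)%:R / (n - j)%:R + 2 = (2 * n)%:R / (n - j)%:R :> F.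
  rewrite -[X in _ + X](mulfK (lt0r_neq0 nj)) -mulrDl; congr (_ / _).
  by rewrite -natrM -natrD -mulnDr subnKC // ltnW.
rewrite !exprMn !exprVn ler_pdivlMr ?exprn_gt0 // => H.
rewrite -(@ler_pM2l _ (2 ^ j)%:R) ?ltr0n ?expn_gt0 //.
rewrite -natrM mulnA -expnD subnKC ?(ltnW jn) //.
rewrite -expnMn [leRHS]natrX; apply: le_trans H; rewrite le_eqVlt; apply/orP; left; apply/eqP.
rewrite natrX natrM !natrX [(2 * j)%:R]natrM exprMn.
rewrite -[X in _ = _ * _ ^+ X](subnK (ltnW jn)) exprD; field.
by rewrite lt0r_neq0 // exprn_gt0.
Qed.

Lemma card_fset_set_le_size (T : choiceType) (A : set T) (s : seq T) :
  (forall x, A x -> x \in s) -> finite_set A /\ (#|` fset_set A| <= size s)%N.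
Proof.
move=> As; have finA : finite_set A by apply: sub_finite_set (finite_seq s) => x /As.
split=> //; apply: uniq_leq_size (fset_uniq _) _ => x.
by rewrite in_fset_set // inE => /As.
Qed.

Definition coef_bound (n j : nat) : nat := (2 ^ (n - j) * n ^ n) %/ (j ^ j * (n - j) ^ (n - j)).

(** Coefficient vectors bounded by [coef_bound]: entry j stores the coefficient of X^j, shifted by
    the bound so as to be a natural number. *)
Definition box (n : nat) := {dffun forall j : 'I_n, 'I_(2 * coef_bound n j).+1}.

Lemma card_box n : #|{: box n}| = (\prod_(j < n) (2 * coef_bound n j).+1)%N.
Proof.
rewrite card_dep_ffun foldrE big_image /=.
by apply: eq_bigr => j _; rewrite card_ord.
Qed.

Definition box_poly n (phi : box n) : {poly int} :=
  'X^n + \sum_(j < n) (Posz (phi j) - Posz (coef_bound n j)) *: 'X^j.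

Lemma box_polyP n (P : {poly int}) : P \is monic -> size P = n.+1 ->
  (forall j, (j < n)%N -> (absz (P`_j)%R <= coef_bound n j)%N) -> exists phi : box n, P = box_poly phi.
Proof.
move=> Pm sP Pb.
exists [ffun j : 'I_n => inord (absz (P`_j + (coef_bound n j)%:Z))].
rewrite -[LHS]coefK sP poly_def big_ord_recr /= addrC; congr (_ + _).
  by have /monicP := Pm; rewrite /lead_coef sP /= => ->; rewrite scale1r.
apply: eq_bigr => j _; congr (_ *: _); rewrite ffunE.
have := Pb j (ltn_ord j); move: {Pb}(coef_bound n j) (P`_j : int) => b z zb.
by rewrite inordK; lia.
Qed.

(** The minimal polynomial of a is padded by a power of X to get degree n exactly, which adds zero
    roots only.  The mean of the moduli stays at most 2, since |w| <= |w|^2 / 4 + 1. *)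
Lemma root_of_box_poly (R : realType) (n : nat) (a : algC) :
  indecomposable R a -> (degree a <= n)%N ->
  exists phi : box n, root (map_poly intr (box_poly phi)) a.
Proof.
move=> ia; rewrite degreeE => dn.
have [aint a0 _] := ia.
have [T aT] := conjugates_exist R[i] a.
have T4 := sum_conjugates_le4 ia aT.
have sT := size_conjugates aT.
have [p pm pE] := Aint_rat_minpoly aint.
set d := (size (rat_minpoly a)).-1 in sT dn.
pose P : {poly int} := p * 'X^(n - d).
have Pm : P \is monic by rewrite monicMr // monicXn.
have sp : size p = d.+1.
  rewrite -(size_map_inj_poly (@intr_inj rat)) ?rmorph0 // -pE /d prednK //.
  by rewrite ltnW // rat_minpoly_gt1.
have sP : size P = n.+1.
  by rewrite size_monicM ?monicXn -?size_poly_eq0 ?size_polyXn // sp addSn addnS /= subnKC.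
(* The roots of P, with multiplicity. *)
pose T' := T ++ nseq (n - d) 0.
have sT' : size T' = n by rewrite size_cat size_nseq sT subnKC.
have T'2 : \sum_(w <- T') `|w| <= 2 * n%:R.
  rewrite big_cat /= [X in _ + X]big_nseq normr0 iter_addr_0 mul0rn addr0.
  apply: le_trans (_ : \sum_(w <- T) (4^-1 * `|w| ^+ 2 + 1) <= _).
    apply: ler_sum => w _; rewrite -subr_ge0.
    have -> : 4^-1 * `|w| ^+ 2 + 1 - `|w| = (`|w| / 2 - 1) ^+ 2 by field.
    by rewrite real_exprn_even_ge0 // rpredB ?rpredM ?normr_real.
  rewrite big_split /= -mulr_sumr big_const_seq count_predT iter_addr_0.
  apply: le_trans (_ : (size T)%:R + (size T)%:R <= _).
    by rewrite lerD2r ler_pdivrMl.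
  by rewrite -mulr2n -[_ *+ 2]mulr_natl ler_wpM2l // ler_nat sT.
have PE : map_poly intr P = \prod_(w <- T') ('X - w%:P).
  rewrite big_cat /= -aT pE map_ratr_intr rmorphM /= map_polyXn; congr (_ * _).
  by rewrite big_nseq subr0 iter_mulr_1.
have [phi phiE] : exists phi : box n, P = box_poly phi.
  apply: box_polyP => // j jn; rewrite /coef_bound leq_divRL; last first.
    by rewrite muln_gt0 !expn_gt0 subn_gt0 jn andbT; case: (j).
  rewrite -(ler_nat R[i]); have := coef_entropy_bound sT' jn T'2.
  by rewrite -PE coef_map /= -intr_norm -natr_absz !natrM.
exists phi; rewrite -phiE rmorphM /= rootM; apply/orP; left.
by rewrite -map_ratr_intr -pE root_rat_minpoly.
Qed.

Lemma indecomposables_finite (R : realType) (n : nat) :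
  finite_set (indecomposables_upto R n) /\
  (#|` fset_set (indecomposables_upto R n)| <= n * \prod_(j < n) (2 * coef_bound n j).+1)%N.
Proof.
have box_roots (phi : box n) : exists2 s : seq algC, size s = n &
    forall a, root (map_poly intr (box_poly phi)) a -> a \in s.
  set S := \sum_(j < n) (Posz (phi j) - Posz (coef_bound n j)) *: 'X^j : {poly int}.
  have szS : (size S <= n)%N.
    apply: leq_trans (size_sum _ _ _) _; apply/bigmax_leqP => j _.
    by apply: leq_trans (size_scale_leq _ _) _; rewrite size_polyXn.
  have phim : box_poly phi \is monic.
    by rewrite monicE lead_coefDl ?lead_coefXn // size_polyXn ltnS.
  have sphi : size (box_poly phi) = n.+1 by rewrite size_polyDl size_polyXn // ltnS.
  have [s sE] := closed_field_poly_normal (map_poly intr (box_poly phi) : {poly algC}).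
  have phiCm : map_poly intr (box_poly phi) \is @monic algC by exact: monic_map.
  rewrite (monicP phiCm) scale1r in sE.
  exists s => [|a]; last by rewrite sE root_prod_XsubC.
  apply: succn_inj; rewrite -(size_prod_XsubC s id) -sE.
  by rewrite (size_map_inj_poly (@intr_inj algC)) ?rmorph0.
have [s ss sP] := fin_all_exists2 box_roots.
have [|finA cA] := @card_fset_set_le_size _ (indecomposables_upto R n)
    (flatten [seq s phi | phi : box n]).
  move=> a [ia dn]; have [phi pa] := root_of_box_poly ia dn.
  by apply/flattenP; exists (s phi); [apply: map_f; rewrite mem_enum | apply: sP].
split=> //; apply: leq_trans cA _; rewrite size_flatten /shape -map_comp sumnE big_map big_enum /=.
by under eq_bigr => phi _ do rewrite ss; rewrite sum_nat_const card_box mulnC.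
Qed.

(** * Size of the coefficient box *)

Definition xlnx (R : realType) (m : nat) : R := m%:R * ln m%:R.

Lemma expR_xlnx (R : realType) (m : nat) : expR (xlnx R m) = (m ^ m)%:R.
Proof.
case: m => [|m]; first by rewrite /xlnx mul0r expR0.
by rewrite /xlnx expRM_natl lnK ?posrE ?ltr0n // natrX.
Qed.

(** The right side is a Riemann sum for the integral of x ln x, increasing for x >= 1; the left side
    is its primitive.  The induction step only needs ln (1 + 1/m) <= 1/m. *)
Lemma sum_xlnx_ge (R : realType) (n : nat) : (0 < n)%N ->
  n%:R ^+ 2 / 2 * ln n%:R - n%:R ^+ 2 / 4 <= \sum_(j < n.+1) xlnx R j.
Proof.
case: n => // n _; elim: n => [|n IH].
  rewrite !big_ord_recr big_ord0 /= /xlnx !ln1 !mul0r !mulr0; lra.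
rewrite big_ord_recr /=; apply: le_trans (lerD IH (lexx _)).
rewrite /xlnx; set m := n.+1.
have m0 : 0 < m%:R :> R by rewrite ltr0n.
have b0 : 0 <= ln m.+1%:R :> R by rewrite ln_ge0 // ler1n.
have ba : m%:R * (ln m.+1%:R - ln m%:R) <= 1 :> R.
  rewrite -ln_div ?posrE ?ltr0n //.
  have -> : m.+1%:R / m%:R = 1 + m%:R^-1 :> R by rewrite -natr1 mulrDl divff ?gt_eqF // mul1r.
  rewrite -[leRHS](mulfV (lt0r_neq0 m0)) ler_wpM2l ?(ltW m0) //. rewrite le_ln1Dx //.
  by rewrite (lt_le_trans _ (_ : 0 <= _)) // ?invr_ge0 ?ltW.
have ba2 : m%:R ^+ 2 * (ln m.+1%:R - ln m%:R) <= m%:R :> R.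
  by rewrite expr2 -mulrA -[leRHS]mulr1 ler_wpM2l // ltW.
have mS : m.+1%:R = m%:R + 1 :> R by rewrite natr1.
move: (ln m.+1%:R) (ln m%:R) b0 ba2 => b a; rewrite mS.
lra.
Qed.

Definition upper_error (R : realType) (n : nat) : R :=
  n%:R * (ln 3 + ln 2 / 2) + xlnx R n + ln n%:R.

Lemma coef_bound_le (R : realType) (n j : nat) : (j < n)%N ->
  (2 * coef_bound n j).+1%:R <=
  expR (ln 3 + (n - j)%:R * ln 2 + xlnx R n - xlnx R j - xlnx R (n - j)).
Proof.
move=> jn; rewrite !expRD !expRN !expR_xlnx expRM_natl !lnK ?posrE ?ltr0n //.
have den0 k : 0 < (k ^ k)%:R :> R by rewrite ltr0n expn_gt0; case: k.
have den : 0 < (j ^ j * (n - j) ^ (n - j))%:R :> R by rewrite natrM mulr_gt0.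
rewrite -mulrA -invfM -natrM ler_pdivlMr // -!natrX -!natrM ler_nat.
have M := leq_divM (2 ^ (n - j) * n ^ n) (j ^ j * (n - j) ^ (n - j)).
rewrite -/(coef_bound n j) in M.
have D : (j ^ j * (n - j) ^ (n - j) <= 2 ^ (n - j) * n ^ n)%N.
  apply: (@leq_trans (n ^ n)); last by rewrite leq_pmull // expn_gt0.
  have -> : (n ^ n = n ^ j * n ^ (n - j))%N by rewrite -expnD subnKC // ltnW.
  rewrite leq_mul //; last by rewrite leq_exp2r ?subn_gt0 // leq_subr.
  by case: (j) jn => // k kn; rewrite leq_exp2r // ltnW.
nia.
Qed.

(** The logarithm of the product is n^2 ln n - 2 (sum of j ln j) + ln 2 (n^2 / 2) up to O(n ln n); by
    [sum_xlnx_ge] the terms n^2 ln n cancel and n^2 / 2 remains. *)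
Lemma indecomposables_upper (R : realType) (n : nat) : (0 < n)%N ->
  (n * \prod_(j < n) (2 * coef_bound n j).+1)%:R <=
  expR (2^-1 * (1 + ln 2) * n%:R ^+ 2 + upper_error R n).
Proof.
move=> n0; rewrite natrM natr_prod.
apply: le_trans (_ : expR (ln n%:R) * \prod_(j < n)
    expR (ln 3 + (n - j)%:R * ln 2 + xlnx R n - xlnx R j - xlnx R (n - j)) <= _).
  rewrite lnK ?posrE ?ltr0n // ler_wpM2l //; apply: ler_prod => j _.
  by rewrite ler0n coef_bound_le.
rewrite -expR_sum -expRD ler_expR.
have S := sum_xlnx_ge R n0.
have x0 : xlnx R 0 = 0 by rewrite /xlnx mul0r.
have S1 : \sum_(j < n) xlnx R j = \sum_(j < n.+1) xlnx R j - xlnx R n.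
  by rewrite big_ord_recr /= addrK.
have S2 : \sum_(j < n) xlnx R (n - j) = \sum_(j < n.+1) xlnx R j.
  rewrite [RHS]big_ord_recl x0 add0r (reindex_inj rev_ord_inj) /=.
  by apply: eq_bigr => j _; rewrite subKn.
have S3 : \sum_(j < n) (n - j)%:R = n%:R * (n%:R + 1) / 2 :> R.
  rewrite (reindex_inj rev_ord_inj) /=.
  rewrite (eq_bigr (fun j : 'I_n => (j.+1)%:R)) => [|j _]; last by rewrite subKn.
  elim: (n) => [|k IH]; first by rewrite big_ord0 !mul0r.
  by rewrite big_ord_recr /= IH -natr1; field.
rewrite !sumrB !big_split /= S1 S2 -mulr_suml S3 !sumr_const card_ord.
rewrite -[ln 3 *+ n]mulr_natl -[xlnx R n *+ n]mulr_natl /upper_error.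
have xn : n%:R * xlnx R n = n%:R ^+ 2 * ln n%:R by rewrite /xlnx mulrA.
rewrite xn; move: S xn; move: (\sum_(j < n.+1) _) => T S xn.
lra.
Qed.

(** * Many Eisenstein polynomials with small roots *)

(** Here 2 c sqrt 2^(j + 1) <= sqrt 2^(N + 1) / (N + 2) for all c up to this bound: each of the N + 1
    lower terms of [eisenstein_poly] may use a share 1 / (N + 2) of the leading one at sqrt 2. *)
Definition eisenstein_bound (R : realType) (N j : nat) : nat :=
  Num.truncn (Num.sqrt 2 ^+ (N - j) / (2 * N.+2)%:R : R).

Definition eisenstein_box (R : realType) (N : nat) :=
  {dffun forall j : 'I_N, 'I_(eisenstein_bound R N j).+1}.

Definition eisenstein_tail (R : realType) (N : nat) (phi : eisenstein_box R N) : {poly int} :=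
  2%:P + \sum_(j < N) Posz (2 * phi j) *: 'X^(j.+1).

Definition eisenstein_poly (R : realType) (N : nat) (phi : eisenstein_box R N) : {poly int} :=
  'X^(N.+1) + eisenstein_tail phi.

Lemma eisenstein_poly_tail_size (R : realType) (N : nat) (phi : eisenstein_box R N)
  :
  (size (eisenstein_tail phi) <= N.+1)%N.
Proof.
apply: leq_trans (size_polyD _ _) _; rewrite geq_max; apply/andP; split.
  by rewrite (leq_trans (size_polyC_leq1 _)).
apply: leq_trans (size_sum _ _ _) _; apply/bigmax_leqP => j _.
by apply: leq_trans (size_scale_leq _ _) _; rewrite size_polyXn ltnS.
Qed.

Lemma size_eisenstein_poly (R : realType) (N : nat) (phi : eisenstein_box R N) :
  size (eisenstein_poly phi) = N.+2.
Proof. by rewrite size_polyDl size_polyXn // ltnS eisenstein_poly_tail_size. Qed.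

Lemma eisenstein_poly_monic (R : realType) (N : nat) (phi : eisenstein_box R N) :
  eisenstein_poly phi \is monic.
Proof. by rewrite monicE lead_coefDl ?lead_coefXn // size_polyXn ltnS eisenstein_poly_tail_size. Qed.

Lemma eisenstein_poly_coef0 (R : realType) (N : nat) (phi : eisenstein_box R N) :
  (eisenstein_poly phi)`_0 = 2.
Proof.
rewrite /eisenstein_poly /eisenstein_tail !coefD coefXn coefC /= coef_sum big1 ?addr0 ?add0r // => j _.
by rewrite coefZ coefXn mulr0.
Qed.

Lemma eisenstein_poly_coefS (R : realType) (N : nat) (phi : eisenstein_box R N) (j : 'I_N) :
  (eisenstein_poly phi)`_j.+1 = Posz (2 * phi j).
Proof.
rewrite /eisenstein_poly /eisenstein_tail !coefD coefXn coefC /= coef_sum (bigD1 j) //= big1 ?addr0.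
  by rewrite coefZ coefXn eqxx mulr1 eqSS ltn_eqF // add0r add0r.
by move=> i ij; rewrite coefZ coefXn eqSS eq_sym (negPf (_ : val i != val j)) ?mulr0.
Qed.

Lemma eisenstein_poly_irreducible (R : realType) (N : nat) (phi : eisenstein_box R N) :
  irreducible_poly (eisenstein_poly phi).
Proof.
apply: (@eisenstein_crit 2) => //; first by rewrite size_eisenstein_poly.
- by rewrite (monicP (eisenstein_poly_monic phi)).
- by rewrite eisenstein_poly_coef0.
rewrite size_eisenstein_poly /= => -[_|i]; first by rewrite eisenstein_poly_coef0.
rewrite ltnS => iN; have := eisenstein_poly_coefS phi (Ordinal iN) => /= ->.
by rewrite PoszM dvdz_mulr.
Qed.

Lemma eisenstein_poly_min (R : realType) (N : nat) (phi : eisenstein_box R N) (a : algC) :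
  root (map_poly intr (eisenstein_poly phi)) a ->
  rat_minpoly a = map_poly intr (eisenstein_poly phi).
Proof.
rewrite -map_ratr_intr root_rat_minpoly => adiv.
have [_ irr] := (irreducible_rat_int _).2 (eisenstein_poly_irreducible phi).
have := irr _ _ adiv; rewrite eqp_monic;
  first by move=> /(_ _)/eqP; apply; rewrite neq_ltn rat_minpoly_gt1 orbT.
  by case: (rat_minpolyP a).
exact/monic_map/eisenstein_poly_monic.
Qed.

Lemma eisenstein_poly_inj (R : realType) (N : nat) : injective (@eisenstein_poly R N).
Proof.
move=> phi psi E; apply/ffunP => j; apply: val_inj.
have := congr1 (fun p : {poly int} => p`_j.+1) E; rewrite !eisenstein_poly_coefS => -[].
by move=> /eqP; rewrite !mul2n => /eqP /double_inj.
Qed.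

Lemma sqrt2_gt0 (R : realType) : 0 < Num.sqrt 2 :> R.
Proof. by rewrite sqrtr_gt0 ltr0n. Qed.

(** On the circle of radius sqrt 2 every lower term is at most a fraction 1 / (N + 2) of the leading
    one, and there are N + 1 of them.  The size condition on N is what the constant term 2 needs. *)
Lemma eisenstein_poly_root_small (R : realType) (N : nat) (phi : eisenstein_box R N) (w : R[i]) :
  (4 * N.+2 ^ 2 <= 2 ^ N.+1)%N ->
  root (map_poly intr (eisenstein_poly phi)) w -> `|w| ^+ 2 < 2.
Proof.
move=> Nbig wr; pose s : R := Num.sqrt 2; have s0 : 0 < s := sqrt2_gt0 R.
have s2 : s ^+ 2 = 2 by rewrite sqr_sqrtr.
have sC : (real_complex R s) ^+ 2 = 2 by rewrite -rmorphXn s2 rmorph_nat.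
have sC0 : 0 < real_complex R s by rewrite (ltcR 0).
rewrite -sC ltr_pXn2r ?nnegrE ?normr_ge0 ?(ltW sC0) //.
pose c k : R[i] := ((eisenstein_poly phi)`_k)%:~R.
apply: (@root_norm_lt _ w (real_complex R s) N.+1 N.+1 c) => //; last first.
  move/rootP: wr; rewrite horner_coef (size_map_inj_poly (@intr_inj R[i])) ?rmorph0 //.
  rewrite size_eisenstein_poly big_ord_recr /= coef_map /=.
  have /monicP := eisenstein_poly_monic phi; rewrite /lead_coef size_eisenstein_poly /= => ->.
  rewrite mul1r addrC => H; rewrite -[RHS]H; congr (_ + _); apply: eq_bigr => k _.
  by rewrite coef_map.
have N2 : 0 < N.+2%:R :> R by rewrite ltr0n.
have term k : (k < N.+1)%N -> `|((eisenstein_poly phi)`_k)%:~R| * s ^+ k <= s ^+ N.+1 / N.+2%:R.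
  case: k => [_|k].
    rewrite eisenstein_poly_coef0 expr0 mulr1 normr_nat ler_pdivlMr //.
    rewrite -(@ler_pXn2r _ 2) ?nnegrE ?mulr_ge0 ?exprn_ge0 ?(ltW s0) //.
    by rewrite exprAC s2 exprMn -!natrX -natrM ler_nat.
  rewrite ltnS => kN; rewrite -[k in (_)`_k.+1]/(val (Ordinal kN)) eisenstein_poly_coefS.
  set x := phi _; have := ltn_ord x; rewrite ltnS /= => xle.
  have : (x%:R : R) <= s ^+ (N - k) / (2 * N.+2)%:R.
    apply: le_trans (_ : (eisenstein_bound R N k)%:R <= _); first by rewrite ler_nat.
    have /Num.Theory.truncn_itv /andP [] // : 0 <= s ^+ (N - k) / (2 * N.+2)%:R.
    by rewrite divr_ge0 ?exprn_ge0 ?ltW.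
  rewrite !ler_pdivlMr ?ltr0n // => H.
  rewrite normr_nat natrM mulrAC -mulrA -(ler_pM2r (exprn_gt0 k.+1 s0)) in H *.
  have NE : N.+1 = (N - k + k.+1)%N by rewrite addnS subnK // -ltnS ltnW.
  rewrite [in leRHS]NE exprD; apply: le_trans H; rewrite natrM le_eqVlt.
  by apply/orP; left; apply/eqP; ring.
have R1 : \sum_(k < N.+1) `|((eisenstein_poly phi)`_k)%:~R| * s ^+ k < s ^+ N.+1.
  apply: le_lt_trans (_ : \sum_(k < N.+1) s ^+ N.+1 / N.+2%:R < _).
    by apply: ler_sum => k _; apply: term.
  rewrite sumr_const card_ord -[_ *+ N.+1]mulr_natr -mulrA gtr_pMr ?exprn_gt0 //.
  by rewrite mulrC ltr_pdivrMr // mul1r ltr_nat.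
move: R1; rewrite -ltcR rmorph_sum rmorphXn /=; apply: le_lt_trans.
rewrite le_eqVlt; apply/orP; left; apply/eqP; apply: eq_bigr => k _.
rewrite rmorphM rmorphXn /=; congr (_ * _).
by rewrite /c -!intr_norm rmorph_int.
Qed.

Lemma eisenstein_poly_root_indecomposable (R : realType) (N : nat)
    (phi : eisenstein_box R N) (a : algC) :
  
  (4 * N.+2 ^ 2 <= 2 ^ N.+1)%N -> root (map_poly intr (eisenstein_poly phi)) a ->
  indecomposables_upto R N.+1 a.
Proof.
move=> Nbig pa; have aE := eisenstein_poly_min pa; split; last first.
  by rewrite degreeE aE (size_map_inj_poly (@intr_inj rat)) ?rmorph0 // size_eisenstein_poly.
apply: indecomposable_of_small_conjugates.
- by apply/Aint_integralOver; exists (eisenstein_poly phi) => //; apply: eisenstein_poly_monic.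
- apply/eqP => a0; move: pa; rewrite a0 rootE horner_coef0 coef_map eisenstein_poly_coef0 /=.
  by rewrite intr_eq0.
- by move=> w; rewrite aE map_ratr_intr; apply: eisenstein_poly_root_small.
Qed.

Lemma card_eisenstein_box (R : realType) (N : nat) :
  #|{: eisenstein_box R N}| = (\prod_(j < N) (eisenstein_bound R N j).+1)%N.
Proof.
rewrite card_dep_ffun foldrE big_image /=.
by apply: eq_bigr => j _; rewrite card_ord.
Qed.

(** Distinct polynomials of the family are distinct minimal polynomials and have no common root. *)
Lemma eisenstein_box_le (R : realType) (N : nat) : (4 * N.+2 ^ 2 <= 2 ^ N.+1)%N ->
  (\prod_(j < N) (eisenstein_bound R N j).+1 <= #|` fset_set (indecomposables_upto R N.+1)|)%N.
Proof.
move=> Nbig; have [finA _] := indecomposables_finite R N.+1.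
have ex (phi : eisenstein_box R N) : exists a : algC, root (map_poly intr (eisenstein_poly phi)) a.
  apply/closed_rootP; rewrite (size_map_inj_poly (@intr_inj algC)) ?rmorph0 //.
  by rewrite size_eisenstein_poly.
have [f fP] := fin_all_exists ex.
have finj : injective f.
  move=> phi psi E; apply: eisenstein_poly_inj; apply: (map_inj_poly (@intr_inj rat)); rewrite ?rmorph0 //.
  by rewrite -(eisenstein_poly_min (fP phi)) -(eisenstein_poly_min (fP psi)) E.
rewrite -card_eisenstein_box cardE -(size_map f); apply: uniq_leq_size.
  by rewrite map_inj_uniq ?enum_uniq.
move=> a /mapP [phi _ ->]; rewrite in_fset_set // inE.
exact: eisenstein_poly_root_indecomposable (fP phi).
Qed.

(** Covers the small degrees, where the Eisenstein polynomials may have large roots. *)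
Lemma indecomposable1 (R : realType) (n : nat) : (0 < n)%N -> indecomposables_upto R n 1.
Proof.
move=> n0.
have div1 : rat_minpoly 1 %| 'X - 1%:P.
  by rewrite -root_rat_minpoly rmorphB /= map_polyX map_polyC /= rmorph1 root_XsubC.
split.
  apply: indecomposable_of_small_conjugates; rewrite ?Aint1 ?oner_eq0 // => w wr.
  have : root (map_poly ratr ('X - 1%:P)) w.
    by move: wr; rewrite -!dvdp_XsubCl => /dvdp_trans; apply; rewrite dvdp_map.
  rewrite rmorphB /= map_polyX map_polyC /= rmorph1 root_XsubC => /eqP ->.
  by rewrite normr1 expr1n (ltr_nat _ 1 2).
rewrite degreeE; apply: leq_trans n0; rewrite -ltnS prednK ?(ltnW (rat_minpoly_gt1 _)) //.
by rewrite (leq_trans (dvdp_leq _ div1)) ?polyXsubC_eq0 ?size_XsubC.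
Qed.

(** For n < 12 it cancels the main term, leaving the bound 1 that [indecomposable1] provides. *)
Definition lower_error (R : realType) (n : nat) : R :=
  if (n < 12)%N then - (4^-1 * ln 2 * n%:R ^+ 2)
  else - (ln 2 / 4 * n%:R + n.-1%:R * ln (2 * n.+1)%:R).

Lemma eisenstein_bound_ge (R : realType) (N : nat) :
  expR (4^-1 * ln 2 * N.+1%:R ^+ 2 - (ln 2 / 4 * N.+1%:R + N%:R * ln (2 * N.+2)%:R)) <=
  (\prod_(j < N) (eisenstein_bound R N j).+1)%:R :> R.
Proof.
pose s : R := Num.sqrt 2.
have s0 : 0 < s := sqrt2_gt0 R.
have lns : ln s = ln 2 / 2.
  have : ln (s ^+ 2) = ln 2 :> R by rewrite sqr_sqrtr.
  by rewrite lnXn // => <-; rewrite -[ln s *+ 2]mulr_natr mulfK // pnatr_eq0.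
rewrite natr_prod.
apply: le_trans (_ : \prod_(j < N) expR ((N - j)%:R * ln s - ln (2 * N.+2)%:R) <= _); last first.
  apply: ler_prod => j _; rewrite expR_ge0 /=.
  rewrite expRD expRN expRM_natl !lnK ?posrE ?ltr0n //.
  have /Num.Theory.truncn_itv /andP [_ /ltW] // : 0 <= s ^+ (N - j) / (2 * N.+2)%:R.
  by rewrite divr_ge0 ?exprn_ge0 ?ltW.
rewrite -expR_sum ler_expR sumrB -mulr_suml.
have -> : \sum_(j < N) (N - j)%:R = N%:R * (N%:R + 1) / 2 :> R.
  rewrite (reindex_inj rev_ord_inj) /=.
  rewrite (eq_bigr (fun j : 'I_N => (j.+1)%:R)) => [|j _]; last by rewrite subKn.
  elim: (N) => [|k IH]; first by rewrite big_ord0 !mul0r.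
  by rewrite big_ord_recr /= IH -natr1; field.
rewrite sumr_const card_ord -[_ *+ N]mulr_natl lns -[N.+1%:R]natr1.
lra.
Qed.

Lemma indecomposables_lower (R : realType) (n : nat) : (0 < n)%N ->
  expR (4^-1 * ln 2 * n%:R ^+ 2 + lower_error R n) <=
  (#|` fset_set (indecomposables_upto R n)|)%:R.
Proof.
move=> n0; have [finA _] := indecomposables_finite R n.
rewrite /lower_error; case: ltnP => [_|n12].
  rewrite subrr expR0 ler1n cardfs_gt0; apply/fset0Pn; exists 1.
  by rewrite in_fset_set // inE; apply: indecomposable1.
case: n n0 n12 {finA} => // N _ N11.
apply: le_trans (eisenstein_bound_ge R N) _.
rewrite ler_nat eisenstein_box_le //.
elim: N N11 => // N IH; rewrite leq_eqVlt => /predU1P [<- //|N12]; have := IH N12.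
rewrite [in X in _ -> (_ <= X)%N]expnS -!mulnn; move: (2 ^ _)%N => M. nia.
Qed.

(** * The error terms and the theorem *)

Lemma xlnx_bigO (R : realType) (e : nat -> R) (c : R) (m : nat) :
  (forall n, (m <= n)%N -> `|e n| <= c * (n%:R * ln n%:R)) ->
  e =O_\oo (fun n : nat => n%:R * ln n%:R : R).
Proof.
move=> H; apply/eqO_exP; exists (`|c| + 1); first by rewrite ltr_wpDl.
exists m.+1 => // n /= mn.
apply: le_trans (H n (ltnW mn)) _.
have n0 : 0 <= n%:R * ln n%:R :> R.
  by rewrite mulr_ge0 // ln_ge0 // ler1n (leq_trans _ mn).
by rewrite [leRHS]/= (ger0_norm n0) ler_wpM2r // (le_trans (ler_norm c)) // lerDl.
Qed.

Lemma ln_nat_le (R : realType) (m n : nat) : (0 < m)%N -> (m <= n)%N ->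
  ln m%:R <= ln n%:R :> R.
Proof.
by move=> m0 mn; rewrite ler_ln ?posrE ?ltr0n ?ler_nat // (leq_trans m0 mn).
Qed.

Lemma upper_error_bigO (R : realType) :
  upper_error R =O_\oo (fun n : nat => n%:R * ln n%:R : R).
Proof.
apply: (@xlnx_bigO _ _ 4 3) => n n3.
have n1 : (0 < n)%N by apply: leq_trans n3.
have l3 := @ln_nat_le R 3 n isT n3.
have l2 := @ln_nat_le R 2 n isT (ltnW n3).
have l20 : 0 <= ln 2 :> R by rewrite ln_ge0 // ler1n.
have l30 : 0 <= ln 3 :> R by rewrite ln_ge0 // ler1n.
have N1 : 1 <= n%:R :> R by rewrite ler1n.
rewrite /upper_error /xlnx ger0_norm; last first.
  by rewrite !addr_ge0 ?mulr_ge0 ?ln_ge0 ?addr_ge0 // divr_ge0.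
move: (ln n%:R) (ln 3) (ln 2) l2 l3 l20 l30 => a b c l2 l3 l20 l30.
nra.
Qed.

Lemma lower_error_bigO (R : realType) :
  lower_error R =O_\oo (fun n : nat => n%:R * ln n%:R : R).
Proof.
apply: (@xlnx_bigO _ _ 3 12) => n n12.
have n1 : (0 < n)%N by apply: leq_trans n12.
have l2 := @ln_nat_le R 2 n isT (leq_trans _ n12).
have l20 : 0 <= ln 2 :> R by rewrite ln_ge0 // ler1n.
have N1 : 1 <= n%:R :> R by rewrite ler1n.
have lm : ln (2 * n.+1)%:R <= 2 * ln n%:R :> R.
  have -> : 2 * ln n%:R = ln (n ^ 2)%:R :> R by rewrite natrX lnXn ?ltr0n // mulr_natl.
  by apply: ln_nat_le => //; rewrite -mulnn; nia.
have lm0 : 0 <= ln (2 * n.+1)%:R :> R by rewrite ln_ge0 // ler1n muln_gt0.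
have nn : n.-1%:R = n%:R - 1 :> R by rewrite -[in RHS](prednK n1) -natr1 addrK.
rewrite /lower_error ltnNge n12 /= normrN nn ger0_norm; last first.
  by rewrite addr_ge0 ?mulr_ge0 ?divr_ge0 // subr_ge0.
move: l2 l20 lm lm0 => /(_ isT); move: (ln n%:R) (ln 2) (ln (2 * n.+1)%:R) => a b c l2 l20 lm lm0.
nra.
Qed.

Theorem theorem1p3 (R : realType) :
  exists e1 e2 : nat -> R,
    [/\ e1 =O_\oo (fun n : nat => n%:R * ln n%:R : R),
        e2 =O_\oo (fun n : nat => n%:R * ln n%:R : R) &
        forall n : nat, (0 < n)%N ->
          [/\ finite_set (indecomposables_upto R n),
              expR (4^-1 * ln 2 * n%:R ^+ 2 + e1 n)
                <= (#|` fset_set (indecomposables_upto R n)|)%:R &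
              (#|` fset_set (indecomposables_upto R n)|)%:R
                <= expR (2^-1 * (1 + ln 2) * n%:R ^+ 2 + e2 n)]].
Proof.
exists (lower_error R), (upper_error R).
split; [exact: lower_error_bigO | exact: upper_error_bigO |].
move=> n n0; have [finA cardA] := indecomposables_finite R n.
split=> //; first exact: indecomposables_lower.
apply: le_trans (indecomposables_upper R n0); rewrite ler_nat //.
Qed.
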